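(* Let $\Gamma=(S,E)$ be a finite graph, $U$ a topological group, $\mathcal{O}\le U$ an open subgroup and $\varphi\colon\mathcal{O}\hookrightarrow U$ a continuous open monomorphism. Let $\widetilde{\Sigma}_\Gamma$ denote the universal Salvetti complex of the abstract RAAG $A_\Gamma$. Then: (1) The map $A_\Gamma\to\mathcal{A}_\Gamma(\varphi)/U$, $a\mapsto aU$, induces an embedding of cubed complexes $\widetilde{\Sigma}_\Gamma\hookrightarrow\widetilde{S}_\Gamma(\varphi)$. (2) $\widetilde{S}_\Gamma(\varphi)$ is a (path-)connected cubed complex of finite dimension $d_\Gamma=\max\{|T|\colon T\subseteq S\text{ is empty or spans a clique in }\Gamma\}$. In particular, $\widetilde{S}_\Gamma(\varphi)$ has the same dimension as $\widetilde{\Sigma}_\Gamma$. (3) The $1$-skeleton of $\widetilde{S}_\Gamma(\varphi)$ is locally finite if and only if both indices $|U:\mathcal{O}|$ and $|U:\varphi(\mathcal{O})|$ are finite. (4) Suppose $U$ is locally compact. Then the $1$-skeleton of $\widetilde{S}_\Gamma(\varphi)$ is a Cayley--Abels graph for $\mathcal{A}_\Gamma(\varphi)$ if and only if $U$ is compact. (5) The length pseudo-metric on $\widetilde{S}_\Gamma(\varphi)$ is a metric. Moreover, endowed with this metric, $\widetilde{S}_\Gamma(\varphi)$ is a complete geodesic metric space.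
   Context: All topological groups are Hausdorff; graphs are simplicial with non-empty vertex set. A continuous open monomorphism is an injective group homomorphism that is continuous and open. Topological RAAG: $A_\Gamma=\langle S\mid sts^{-1}t^{-1},\{s,t\}\in E\rangle$; put $\mathcal{H}_S(\varphi)=(U*F(S))/\langle\langle t\omega t^{-1}\varphi(\omega)^{-1}\mid t\in S,\omega\in\mathcal{O}\rangle\rangle$, with the unique group topology making the canonical embedding $U\hookrightarrow\mathcal{H}_S(\varphi)$ continuous and open; $\mathcal{A}_\Gamma(\varphi)=\mathcal{H}_S(\varphi)/\langle\langle sts^{-1}t^{-1}\mid\{s,t\}\in E\rangle\rangle$ with the quotient topology. $U$ and $A_\Gamma$ embed canonically in $\mathcal{A}_\Gamma(\varphi)$ and are identified with their images. Generalised universal Salvetti complex $\widetilde{S}_\Gamma(\varphi)$: vertices are the cosets $gU$, $g\in\mathcal{A}_\Gamma(\varphi)$. For each $g$ and each $T=\{t_1,\dots,t_k\}\subseteq S$ that is empty or spans a clique of $\Gamma$, there is a $k$-dimensional Euclidean unit cube $gQ_T$ with vertex set $\{gt_1^{\varepsilon_1}\cdots t_k^{\varepsilon_k}U\mid\varepsilon_i\in\{0,1\}\}$, the vertex indexed by $\varepsilon$ corresponding to $\varepsilon\in[0,1]^k$; faces are the corresponding lower-dimensional cubes of this kind, and a cell is determined by its vertex set. This is a cubed complex (cells are Euclidean unit cubes, attaching maps are isometries on faces), with the induced length pseudo-metric extending the Euclidean metrics of the cubes. The universal Salvetti complex $\widetilde{\Sigma}_\Gamma$ of $A_\Gamma$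 is the same construction with $U$ trivial (vertex set $A_\Gamma$, cubes $\{at_1^{\varepsilon_1}\cdots t_k^{\varepsilon_k}\}$). A Cayley--Abels graph for $G$ is a locally finite connected simplicial graph on which $G$ acts vertex-transitively with compact open vertex stabilisers. *)

(* Defs.v *)
From Stdlib Require Import Relations.
From HB Require Import structures.
From mathcomp Require Import all_boot all_order all_algebra.
From mathcomp Require Import all_classical all_reals.
From mathcomp Require Import topology normedtype ereal.

Set Implicit Arguments.
Unset Strict Implicit.
Unset Printing Implicit Defensive.

Import Order.TTheory GRing.Theory Num.Theory numFieldNormedType.Exports.

Local Open Scope classical_set_scope.

#[short(type="preTopologicalGroupType")]
HB.structure Definition PreTopologicalGroup :=
  {G of Topological G & Group G}.

Definition group_topology (G : preTopologicalGroupType) : Prop :=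
  continuous (fun x : G * G => (x.1 * x.2)%g) /\
  continuous (fun x : G => (x^-1)%g).

HB.mixin Record PreTopologicalGroup_isTopologicalGroup G
    & PreTopologicalGroup G := {
  group_topologyP : group_topology G
}.

#[short(type="topologicalGroupType")]
HB.structure Definition TopologicalGroup :=
  {G of PreTopologicalGroup G & PreTopologicalGroup_isTopologicalGroup G}.

Definition is_subgroup (G : groupType) (K : set G) : Prop :=
  [/\ K 1%g, forall x y, K x -> K y -> K (x * y)%g
    & forall x, K x -> K (x^-1)%g].

Definition is_normal_subgroup (G : groupType) (K : set G) : Prop :=
  is_subgroup K /\ forall x g, K x -> K (x ^ g)%g.

Definition normal_closure (G : groupType) (R : set G) : set G :=
  smallest (@is_normal_subgroup G) R.

(** Cosets are represented as subsets of the group. *)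
Definition lcoset (G : groupType) (K : set G) (g : G) : set G :=
  [set (g * k)%g | k in K].

Definition finite_index (G : groupType) (K : set G) : Prop :=
  finite_set (range (lcoset K)).

Section NormalClosure.
Context (G : groupType) (R : set G).

Lemma normal_closure_normal : is_normal_subgroup (normal_closure R).
Proof.
split; first split.
- by move=> K [[[]]].
- by move=> x y Nx Ny K KP; case: (KP) => [[[_ KM _] _] _]; apply: KM;
    [exact: Nx|exact: Ny].
- by move=> x Nx K KP; case: (KP) => [[[_ _ KV] _] _]; apply: KV; exact: Nx.
- by move=> x g Nx K KP; case: (KP) => [[_ KJ] _]; apply: KJ; exact: Nx.
Qed.

Lemma sub_normal_closure : R `<=` normal_closure R.
Proof. by move=> x Rx K [_]; apply. Qed.

Let N := normal_closure R.
Let N1 : N 1%g. Proof. by case: normal_closure_normal => -[]. Qed.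
Let NM x y : N x -> N y -> N (x * y)%g.
Proof. by case: normal_closure_normal => -[_ + _] _; apply. Qed.
Let NV x : N x -> N (x^-1)%g.
Proof. by case: normal_closure_normal => -[_ _ +] _; apply. Qed.
Let NJ x g : N x -> N (x ^ g)%g.
Proof. by case: normal_closure_normal => _; apply. Qed.

Definition quot_rel (x y : G) : bool := `[< normal_closure R (x^-1 * y)%g >].

Let quot_rel_refl : reflexive quot_rel.
Proof. by move=> x; apply/asboolP; rewrite mulVg. Qed.

Let quot_rel_sym : symmetric quot_rel.
Proof.
by move=> x y; apply/asboolP/asboolP => /NV; rewrite invgM invgK.
Qed.

Let quot_rel_trans : transitive quot_rel.
Proof.
move=> y x z /asboolP xy /asboolP yz; apply/asboolP.
by have := NM xy yz; rewrite mulgA mulgK.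
Qed.

Canonical quot_equiv :=
  EquivRel quot_rel quot_rel_refl quot_rel_sym quot_rel_trans.

Definition quotgrp : Type := {eq_quot quot_equiv}%qT.
HB.instance Definition _ := Choice.on quotgrp.

Local Open Scope quotient_scope.

Definition quotgrp_pi (x : G) : quotgrp := \pi_({eq_quot quot_equiv}) x.
Definition quotgrp_repr (x : quotgrp) : G := repr (x : {eq_quot quot_equiv}).

Lemma quotgrp_reprK : cancel quotgrp_repr quotgrp_pi.
Proof. exact: reprK. Qed.

Lemma quotgrp_eq x y :
  quotgrp_pi x = quotgrp_pi y <-> normal_closure R (x^-1 * y)%g.
Proof.
by split=> [/eqquotP/asboolP//|xy]; apply/eqquotP/asboolP.
Qed.

Definition quotgrp_mul (x y : quotgrp) : quotgrp :=
  quotgrp_pi (quotgrp_repr x * quotgrp_repr y)%g.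
Definition quotgrp_inv (x : quotgrp) : quotgrp :=
  quotgrp_pi (quotgrp_repr x)^-1%g.

Let piM x y : quotgrp_pi (x * y)%g = quotgrp_mul (quotgrp_pi x) (quotgrp_pi y).
Proof.
apply/quotgrp_eq; set x' := quotgrp_repr _; set y' := quotgrp_repr _.
have /quotgrp_eq Nx : quotgrp_pi x = quotgrp_pi x' by rewrite quotgrp_reprK.
have /quotgrp_eq Ny : quotgrp_pi y = quotgrp_pi y' by rewrite quotgrp_reprK.
have -> : ((x * y)^-1 * (x' * y') = ((x^-1 * x') ^ y) * (y^-1 * y'))%g.
  by rewrite conjgE invgM !mulgA mulgK.
by apply: NM => //; exact: NJ.
Qed.

Let piV x : quotgrp_pi x^-1%g = quotgrp_inv (quotgrp_pi x).
Proof.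
apply/quotgrp_eq; set x' := quotgrp_repr _.
have /quotgrp_eq Nx : quotgrp_pi x = quotgrp_pi x' by rewrite quotgrp_reprK.
by have := NJ (x^-1)%g (NV Nx); rewrite conjgE !invgM !invgK mulgK.
Qed.

Let mulA : associative quotgrp_mul.
Proof.
move=> x y z; rewrite -[x]quotgrp_reprK -[y]quotgrp_reprK -[z]quotgrp_reprK.
by rewrite -!piM mulgA.
Qed.
Let mul1 : left_id (quotgrp_pi 1%g) quotgrp_mul.
Proof. by move=> x; rewrite -[x]quotgrp_reprK -piM mul1g. Qed.
Let mulr1 : right_id (quotgrp_pi 1%g) quotgrp_mul.
Proof. by move=> x; rewrite -[x]quotgrp_reprK -piM mulg1. Qed.
Let mulV : left_inverse (quotgrp_pi 1%g) quotgrp_inv quotgrp_mul.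
Proof. by move=> x; rewrite -[x]quotgrp_reprK -piV -piM mulVg. Qed.
Let mulrV : right_inverse (quotgrp_pi 1%g) quotgrp_inv quotgrp_mul.
Proof. by move=> x; rewrite -[x]quotgrp_reprK -piV -piM mulgV. Qed.

HB.instance Definition _ := isGroup.Build quotgrp mulA mul1 mulr1 mulV mulrV.

Lemma quotgrp_piM : {morph quotgrp_pi : x y / (x * y)%g}.
Proof. exact: piM. Qed.

End NormalClosure.

Section QuotientTopology.
Context (G : preTopologicalGroupType) (R : set G).

Definition quotgrp_open (V : set (quotgrp R)) : Prop :=
  open (@quotgrp_pi G R @^-1` V).

Let openT_ : quotgrp_open setT.
Proof. by rewrite /quotgrp_open preimage_setT; exact: openT. Qed.
Let openI_ (V W : set (quotgrp R)) :
  quotgrp_open V -> quotgrp_open W -> quotgrp_open (V `&` W).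
Proof. by move=> oV oW; exact: openI. Qed.
Let openU_ (I : Type) (f : I -> set (quotgrp R)) :
  (forall i, quotgrp_open (f i)) -> quotgrp_open (\bigcup_i f i).
Proof. by move=> of_; apply: bigcup_open => i _; exact: of_. Qed.

HB.instance Definition _ :=
  isOpenTopological.Build (quotgrp R) openT_ openI_ openU_.

End QuotientTopology.

(** Words over [X] modulo the congruence generated by [r] and by
   [i x] being a two-sided inverse of [x]. *)

Section Words.
Context (X : choiceType) (i : X -> X) (r : seq X -> seq X -> Prop).

Inductive word_step : seq X -> seq X -> Prop :=
| word_step_rel u v a b : r a b -> word_step (u ++ a ++ v) (u ++ b ++ v)
| word_step_Vl u v x : word_step (u ++ [:: i x; x] ++ v) (u ++ v)
| word_step_Vr u v x : word_step (u ++ [:: x; i x] ++ v) (u ++ v).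

Local Notation weq := (clos_refl_sym_trans _ word_step).

Definition word_rel (u v : seq X) : bool := `[< weq u v >].

Let word_rel_refl : reflexive word_rel.
Proof. by move=> u; apply/asboolP; exact: rst_refl. Qed.
Let word_rel_sym : symmetric word_rel.
Proof. by move=> u v; apply/asboolP/asboolP; exact: rst_sym. Qed.
Let word_rel_trans : transitive word_rel.
Proof.
by move=> v u w /asboolP uv /asboolP vw; apply/asboolP; exact: rst_trans uv vw.
Qed.

Canonical word_equiv :=
  EquivRel word_rel word_rel_refl word_rel_sym word_rel_trans.

Definition wordgrp : Type := {eq_quot word_equiv}%qT.
HB.instance Definition _ := Choice.on wordgrp.

Local Open Scope quotient_scope.

Definition wordgrp_pi (u : seq X) : wordgrp := \pi_({eq_quot word_equiv}) u.
Definition wordgrp_repr (x : wordgrp) : seq X :=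
  repr (x : {eq_quot word_equiv}).

Lemma wordgrp_reprK : cancel wordgrp_repr wordgrp_pi.
Proof. exact: reprK. Qed.

Lemma wordgrp_eq u v : wordgrp_pi u = wordgrp_pi v <-> weq u v.
Proof. by split=> [/eqquotP/asboolP//|uv]; apply/eqquotP/asboolP. Qed.

Let weq_cat2 u v w w' : weq u v -> weq (w ++ u ++ w') (w ++ v ++ w').
Proof.
elim=> [a b st|a|a b _|a b c _ + _]; last 3 first.
- exact: rst_refl.
- exact: rst_sym.
- exact: rst_trans.
apply: rst_step; case: st => [x y a' b' ab|x y z|x y z].
- have E (c : seq X) : w ++ (x ++ c ++ y) ++ w' = (w ++ x) ++ c ++ (y ++ w').
    by rewrite !catA.
  by rewrite !E; exact: word_step_rel.
- have -> : w ++ (x ++ [:: i z; z] ++ y) ++ w' =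
    (w ++ x) ++ [:: i z; z] ++ (y ++ w') by rewrite !catA.
  have -> : w ++ (x ++ y) ++ w' = (w ++ x) ++ (y ++ w') by rewrite !catA.
  exact: word_step_Vl.
- have -> : w ++ (x ++ [:: z; i z] ++ y) ++ w' =
    (w ++ x) ++ [:: z; i z] ++ (y ++ w') by rewrite !catA.
  have -> : w ++ (x ++ y) ++ w' = (w ++ x) ++ (y ++ w') by rewrite !catA.
  exact: word_step_Vr.
Qed.

Let weq_cat u u' v v' : weq u u' -> weq v v' -> weq (u ++ v) (u' ++ v').
Proof.
move=> uu vv; apply: (@rst_trans _ _ _ (u' ++ v)).
  exact: (weq_cat2 [::] v uu).
by have := weq_cat2 u' [::] vv; rewrite !cats0.
Qed.

Definition word_inv (u : seq X) : seq X := rev (map i u).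

Let word_invl u : weq (word_inv u ++ u) [::].
Proof.
elim: u => [|x u IHu]; first exact: rst_refl.
apply: rst_trans IHu; apply: rst_step.
rewrite /word_inv /= rev_cons -cats1 -catA.
exact: (word_step_Vl (rev (map i u)) u x).
Qed.

Let word_invr u : weq (u ++ word_inv u) [::].
Proof.
elim/last_ind: u => [|u x IHu]; first exact: rst_refl.
apply: rst_trans IHu; apply: rst_step.
rewrite /word_inv map_rcons rev_rcons -cats1 -catA.
exact: (word_step_Vr u (rev (map i u)) x).
Qed.

Definition wordgrp_mul (x y : wordgrp) : wordgrp :=
  wordgrp_pi (wordgrp_repr x ++ wordgrp_repr y).
Definition wordgrp_inv (x : wordgrp) : wordgrp :=
  wordgrp_pi (word_inv (wordgrp_repr x)).

Let piM u v : wordgrp_pi (u ++ v) = wordgrp_mul (wordgrp_pi u) (wordgrp_pi v).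
Proof.
by apply/wordgrp_eq; apply: weq_cat; apply/wordgrp_eq; rewrite wordgrp_reprK.
Qed.

Let mulA : associative wordgrp_mul.
Proof.
move=> x y z; rewrite -[x]wordgrp_reprK -[y]wordgrp_reprK -[z]wordgrp_reprK.
by rewrite -!piM catA.
Qed.
Let mul1 : left_id (wordgrp_pi [::]) wordgrp_mul.
Proof. by move=> x; rewrite -[x]wordgrp_reprK -piM. Qed.
Let mulr1 : right_id (wordgrp_pi [::]) wordgrp_mul.
Proof. by move=> x; rewrite -[x]wordgrp_reprK -piM cats0. Qed.
Let mulV : left_inverse (wordgrp_pi [::]) wordgrp_inv wordgrp_mul.
Proof.
move=> x; rewrite -[X in wordgrp_mul _ X]wordgrp_reprK -piM.
by apply/wordgrp_eq; exact: word_invl.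
Qed.
Let mulrV : right_inverse (wordgrp_pi [::]) wordgrp_inv wordgrp_mul.
Proof.
move=> x; rewrite -[X in wordgrp_mul X _]wordgrp_reprK -piM.
by apply/wordgrp_eq; exact: word_invr.
Qed.

HB.instance Definition _ := isGroup.Build wordgrp mulA mul1 mulr1 mulV mulrV.

Lemma wordgrp_piM u v : wordgrp_pi (u ++ v) = (wordgrp_pi u * wordgrp_pi v)%g.
Proof. exact: piM. Qed.

End Words.

Definition freegrp (S : choiceType) : Type :=
  @wordgrp (S * bool)%type (fun x => (x.1, ~~ x.2)) (fun _ _ => False).
HB.instance Definition _ (S : choiceType) := Group.on (freegrp S).

Definition freegen (S : choiceType) (s : S) : freegrp S :=
  wordgrp_pi _ _ [:: (s, true)].

Section FreeProduct.
Context (G H : groupType).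

Definition freeprod_inv (x : G + H) : G + H :=
  match x with inl g => inl (g^-1)%g | inr h => inr (h^-1)%g end.

Inductive freeprod_rel : seq (G + H) -> seq (G + H) -> Prop :=
| freeprod_rell x y : freeprod_rel [:: inl x; inl y] [:: inl (x * y)%g]
| freeprod_relr x y : freeprod_rel [:: inr x; inr y] [:: inr (x * y)%g].

Definition freeprod : Type := wordgrp freeprod_inv freeprod_rel.
HB.instance Definition _ := Group.on freeprod.

Definition freeprodl (g : G) : freeprod := wordgrp_pi _ _ [:: inl g].
Definition freeprodr (h : H) : freeprod := wordgrp_pi _ _ [:: inr h].

End FreeProduct.

Arguments freeprodl {G H} g.
Arguments freeprodr {G H} h.

Definition commutator_rels (S : Type) (e : rel S) (G : groupType) (j : S -> G) :
    set G :=
  [set x | exists s t, e s t /\ x = (j s * j t * (j s)^-1 * (j t)^-1)%g].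

Section RAAG.
Context (S : finType) (e : rel S).

Definition raag_rels : set (freegrp S) := commutator_rels e (@freegen S).

Definition raag : Type := quotgrp raag_rels.
HB.instance Definition _ := Group.on raag.

Definition raag_gen (s : S) : raag := quotgrp_pi raag_rels (freegen s).

End RAAG.

(** [phi] is only ever used on [O]; it stands for a map [O -> U]. Below,
   [thnn] is [H_S(phi)] and [traag] is [A_Gamma(phi)]. *)
Section TopologicalRAAG.
Context (S : finType) (e : rel S) (U : topologicalGroupType).
Context (O : set U) (phi : U -> U).

Definition thnn_rels : set (freeprod U (freegrp S)) :=
  [set x | exists t w, O w /\
    x = (freeprodr (freegen t) * freeprodl w
         * (freeprodr (freegen t))^-1 * (freeprodl (phi w))^-1)%g].

Definition thnn : Type := quotgrp thnn_rels.
HB.instance Definition _ := Group.on thnn.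

Definition thnn_base (u : U) : thnn := quotgrp_pi thnn_rels (freeprodl u).
Definition thnn_free (a : freegrp S) : thnn :=
  quotgrp_pi thnn_rels (freeprodr a).
Definition thnn_gen (t : S) : thnn := thnn_free (freegen t).

(** The topology for which the left translates of open subsets of the image of
   [U] form a basis; [thnn_topologyP] and [thnn_topology_unique] below show that
   it is the unique group topology making [thnn_base] continuous and open. *)
Definition thnn_open (V : set thnn) : Prop :=
  forall g : thnn, open [set u | V (g * thnn_base u)%g].

Let openT_ : thnn_open setT.
Proof. by move=> g; exact: openT. Qed.
Let openI_ (V W : set thnn) :
  thnn_open V -> thnn_open W -> thnn_open (V `&` W).
Proof. by move=> oV oW g; exact: openI (oV g) (oW g). Qed.
Let openU_ (I : Type) (f : I -> set thnn) :
  (forall i, thnn_open (f i)) -> thnn_open (\bigcup_i f i).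
Proof.
move=> of_ g; have -> : [set u | (\bigcup_i f i) (g * thnn_base u)%g] =
  \bigcup_i [set u | f i (g * thnn_base u)%g] by [].
by apply: bigcup_open => i _; exact: of_.
Qed.

HB.instance Definition _ := isOpenTopological.Build thnn openT_ openI_ openU_.

Definition traag_rels : set thnn := commutator_rels e thnn_gen.

Definition traag : Type := quotgrp traag_rels.
HB.instance Definition _ := Group.on traag.
HB.instance Definition _ := Topological.on traag.

Definition traag_base (u : U) : traag := quotgrp_pi traag_rels (thnn_base u).
Definition traag_gen (t : S) : traag := quotgrp_pi traag_rels (thnn_gen t).

(** The canonical homomorphism [A_Gamma -> A_Gamma(phi)]; independence of the
   chosen representative is [raag_to_traagE]. *)
Definition raag_to_traag (a : raag e) : traag :=
  quotgrp_pi traag_rels (thnn_free (quotgrp_repr a)).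

Lemma freeprodlM : {morph @freeprodl U (freegrp S) : x y / (x * y)%g >-> (x * y)%g}.
Proof.
move=> x y; apply: esym; rewrite /freeprodl -wordgrp_piM; apply/wordgrp_eq.
apply: rst_step; exact: (word_step_rel _ [::] [::] (freeprod_rell _ x y)).
Qed.

Lemma freeprodrM : {morph @freeprodr U (freegrp S) : x y / (x * y)%g >-> (x * y)%g}.
Proof.
move=> x y; apply: esym; rewrite /freeprodr -wordgrp_piM; apply/wordgrp_eq.
apply: rst_step; exact: (word_step_rel _ [::] [::] (freeprod_relr _ x y)).
Qed.

Lemma thnn_baseM : {morph thnn_base : x y / (x * y)%g >-> (x * y)%g}.
Proof. by move=> x y; rewrite /thnn_base freeprodlM quotgrp_piM. Qed.

Lemma thnn_freeM : {morph thnn_free : x y / (x * y)%g >-> (x * y)%g}.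
Proof. by move=> x y; rewrite /thnn_free freeprodrM quotgrp_piM. Qed.

End TopologicalRAAG.

Section GroupTopologyCriterion.
Context (G : preTopologicalGroupType).

Lemma group_topologyE : group_topology G <->
  (forall (x y : G) W, nbhs (x * y)%g W -> exists A B,
     [/\ nbhs x A, nbhs y B & forall a b, A a -> B b -> W (a * b)%g]) /\
  (forall (x : G) W, nbhs (x^-1)%g W -> nbhs x [set a | W (a^-1)%g]).
Proof.
split=> -[mulC invC]; split.
- move=> x y W /(mulC (x, y)) [[A B] /= [nA nB] sAB].
  by exists A, B; split=> // a b Aa Bb; exact: (sAB (a, b)).
- by move=> x W /(invC x).
- move=> [x y] W /= /mulC [A [B [nA nB sAB]]].
  by exists (A, B) => //= -[a b] [/= Aa Bb]; exact: sAB.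
- by move=> x W /invC.
Qed.

End GroupTopologyCriterion.

Section GroupTopologyTheory.
Context (G : preTopologicalGroupType).

Lemma open_nbhsP (A : set G) : open A <-> forall x, A x -> nbhs x A.
Proof. by rewrite openE. Qed.

Hypothesis gtG : group_topology G.

Lemma open_mulgl (A : set G) g : open A -> open [set x | A (g * x)%g].
Proof.
move=> /open_nbhsP oA; apply/open_nbhsP => x /= /oA.
case/group_topologyE: gtG => + _ => /[apply] -[B [C [nB nC BC]]].
by apply: filterS nC => c Cc; apply: BC => //; exact: nbhs_singleton nB.
Qed.

Lemma open_mulgr (A : set G) g : open A -> open [set x | A (x * g)%g].
Proof.
move=> /open_nbhsP oA; apply/open_nbhsP => x /= /oA.
case/group_topologyE: gtG => + _ => /[apply] -[B [C [nB nC BC]]].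
by apply: filterS nB => c Cc; apply: BC => //; exact: nbhs_singleton nC.
Qed.

Lemma quotgrp_pi_open (R : set G) (V : set G) :
  open V -> open (quotgrp_pi R @` V).
Proof.
move=> oV.
suff : open (quotgrp_pi R @^-1` (quotgrp_pi R @` V)) by [].
have -> : quotgrp_pi R @^-1` (quotgrp_pi R @` V) =
  \bigcup_(n in normal_closure R) [set x | V (x * n)%g].
  apply/seteqP; split=> [x [v Vv]|x [n Nn /= Vxn]].
    move=> /esym /quotgrp_eq Nxv; exists (x^-1 * v)%g => //=.
    by rewrite mulgA mulgV mul1g.
  exists (x * n)%g => //=; apply/esym/quotgrp_eq.
  by rewrite mulgA mulVg mul1g.
by apply: bigcup_open => n _; exact: open_mulgr.
Qed.

Lemma quotgrp_topologyP (R : set G) : group_topology (quotgrp R).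
Proof.
have nbhs_pi (x : G) A : nbhs x A -> nbhs (quotgrp_pi R x) (quotgrp_pi R @` A).
  rewrite {1}nbhsE => -[B [oB Bx] BA].
  apply: (@filterS _ _ _ (quotgrp_pi R @` B)); first exact: image_subset.
  by apply: open_nbhs_nbhs; split; [exact: quotgrp_pi_open|exists x].
have pi_nbhs (x : G) A :
    nbhs (quotgrp_pi R x) A -> nbhs x (quotgrp_pi R @^-1` A).
  rewrite {1}nbhsE => -[B [oB Bx] BA].
  by rewrite nbhsE; exists (quotgrp_pi R @^-1` B) => // y /BA.
have piV (x : G) : quotgrp_pi R (x^-1)%g = ((quotgrp_pi R x)^-1)%g.
  apply/esym/mulg1_eq; rewrite -quotgrp_piM mulgV.
  by apply: (@mulgI _ (quotgrp_pi R 1%g)); rewrite -quotgrp_piM !mulg1.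
apply/group_topologyE; split=> [x y W|x W].
  rewrite -[x]quotgrp_reprK -[y]quotgrp_reprK -quotgrp_piM => /pi_nbhs.
  case/group_topologyE: gtG => + _ => /[apply] -[A [B [nA nB AB]]].
  exists (quotgrp_pi R @` A), (quotgrp_pi R @` B).
  split; [exact: nbhs_pi|exact: nbhs_pi|].
  by move=> _ _ [a Aa <-] [b Bb <-]; rewrite -quotgrp_piM; exact: AB.
rewrite -[x]quotgrp_reprK -piV => /pi_nbhs.
case/group_topologyE: gtG => _ => /[apply] /nbhs_pi.
by apply: filterS => _ [a /= Wa <-] /=; rewrite -piV.
Qed.

End GroupTopologyTheory.

Section TopologicalRAAGTheory.
Context (S : finType) (e : rel S) (U : topologicalGroupType).
Context (O : set U) (phi : U -> U).

Local Notation H := (thnn S O phi).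
Local Notation base := (@thnn_base S U O phi).
Local Notation gen := (@thnn_gen S U O phi).

Lemma thnn_rel (t : S) w : O w -> (gen t * base w = base (phi w) * gen t)%g.
Proof.
move=> Ow.
have : (freeprodr (freegen t) * freeprodl w
   * (freeprodr (freegen t))^-1 * (freeprodl (phi w))^-1)%g
   \in normal_closure (@thnn_rels S U O phi).
  by rewrite inE; apply: sub_normal_closure; exists t, w.
set x := freeprodr _; set y := freeprodl w; set z := freeprodl (phi w).
rewrite inE => Nr; rewrite /gen /thnn_free /base -!quotgrp_piM -/x -/y -/z.
apply/esym/quotgrp_eq.
have [_ NJ] := normal_closure_normal (@thnn_rels S U O phi).
have := NJ _ (z * x)%g Nr.
by rewrite conjgE !invgM !mulgA !mulgVK.
Qed.

Let base1 : base 1%g = 1%g.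
Proof.
by apply: (@mulgI _ (base 1%g)); rewrite -thnn_baseM !mulg1.
Qed.

Let baseV u : base (u^-1)%g = ((base u)^-1)%g.
Proof. by apply/esym/mulg1_eq; rewrite -thnn_baseM mulgV base1. Qed.

Lemma thnn_relV (t : S) w : O w ->
  (base w * (gen t)^-1 = (gen t)^-1 * base (phi w))%g.
Proof.
move=> /(thnn_rel t) tw; apply: (@mulgI _ (gen t)).
by rewrite mulgA tw mulgK mulgA mulgV mul1g.
Qed.

Let free1 : thnn_free O phi (1%g : freegrp S) = 1%g.
Proof.
by apply: (@mulgI _ (thnn_free O phi 1%g)); rewrite -thnn_freeM !mulg1.
Qed.

Lemma thnn_ind (P : H -> Prop) :
  P 1%g -> (forall u x, P x -> P (base u * x)%g) ->
  (forall t x, P x -> P (gen t * x)%g) ->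
  (forall t x, P x -> P ((gen t)^-1 * x)%g) ->
  forall x, P x.
Proof.
move=> P1 Pu Pt PtV.
have Pfree a x : P x -> P (thnn_free O phi a * x)%g.
  rewrite -[a]wordgrp_reprK; elim: (wordgrp_repr a) x => [|[t b] w IHw] x Px.
    have -> : wordgrp_pi _ _ [::] = 1%g :> freegrp S by [].
    by rewrite free1 mul1g.
  rewrite (wordgrp_piM _ _ [:: (t, b)] w) thnn_freeM -mulgA.
  have {}IHw := IHw _ Px.
  case: b; first exact: Pt.
  have -> : wordgrp_pi _ _ [:: (t, false)] = ((freegen t)^-1)%g :> freegrp S.
    apply/esym/mulg1_eq; rewrite /freegen -wordgrp_piM.
    apply/wordgrp_eq; apply: rst_step.
    exact: (@word_step_Vr _ _ _ [::] [::] (t, true)).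
  have -> : thnn_free O phi (freegen t)^-1%g = ((gen t)^-1)%g.
    by apply/esym/mulg1_eq; rewrite -thnn_freeM mulgV free1.
  exact: PtV.
move=> x; rewrite -[x]quotgrp_reprK -[quotgrp_repr x]wordgrp_reprK.
rewrite -[quotgrp_pi _ _]mulg1.
elim: (wordgrp_repr _) => [|[u|a] w IHw].
- have -> : quotgrp_pi (@thnn_rels S U O phi) (wordgrp_pi _ _ [::]) = 1%g by [].
  by rewrite mul1g.
- by rewrite (wordgrp_piM _ _ [:: inl u] w) quotgrp_piM -mulgA; exact: Pu.
- by rewrite (wordgrp_piM _ _ [:: inr a] w) quotgrp_piM -mulgA; exact: Pfree.
Qed.

Hypothesis O_subgroup : is_subgroup O.
Hypothesis O_open : open O.
Hypothesis phiM : {in O &, {morph phi : x y / (x * y)%g}}.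
Hypothesis phi_cont : {within O, continuous phi}.
Hypothesis phi_open : forall V, open V -> V `<=` O -> open (phi @` V).

Let gtU : group_topology U := @group_topologyP U.

Let O1 : O 1%g. Proof. by case: O_subgroup. Qed.
Let phi1 : phi 1%g = 1%g.
Proof.
apply: (@mulgI _ (phi 1%g)); rewrite mulg1 -phiM ?mulg1 ?inE//.
Qed.

Let open_thnn (W : set H) :
  open W = forall g : H, open [set u | W (g * base u)%g].
Proof. by []. Qed.

Let open_left (W : set H) h : open W -> open [set x | W (h * x)%g].
Proof.
rewrite !open_thnn => oW g; have := oW (h * g)%g.
by under eq_set do rewrite -mulgA.
Qed.

Let transl (A Q : set U) : (forall u, A u -> exists V : set U,
  [/\ open V, V 1%g & forall v, V v -> A (u * v)%g]) -> open A.
Proof.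
move=> AV; apply/open_nbhsP => u /AV [V [oV V1 VA]].
apply: (@filterS _ _ _ [set x | V (u^-1 * x)%g]) => [x /= /VA|].
  by rewrite mulgA mulgV mul1g.
by apply: open_nbhs_nbhs; split; [exact: open_mulgl|rewrite /= mulVg].
Qed.

Let open_right (W : set H) h : open W -> open [set x | W (x * h)%g].
Proof.
elim/thnn_ind: h W => [W|u h IH W|t h IH W|t h IH W].
- by under eq_set do rewrite mulg1.
- move=> /IH oW; under eq_set do rewrite mulgA.
  move: oW; rewrite !open_thnn => oW g.
  have := open_mulgr gtU u (oW g).
  by congr open; apply: eq_set => v /=; rewrite thnn_baseM !mulgA.
- move=> /IH oW; under eq_set do rewrite mulgA.
  set W' := [set x | W (x * h)%g] in oW; rewrite open_thnn => g.
  apply: (transl setT) => u Wu.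
  exists (phi @` ([set v | W' (g * base u * gen t * base v)%g] `&` O)); split.
  + by apply: phi_open; [apply: openI => //; exact: oW|move=> ? []].
  + by exists 1%g => //; split=> //=; rewrite base1 mulg1.
  + move=> _ [v [Wv Ov] <-] /=; rewrite thnn_baseM -!mulgA.
    by rewrite (mulgA (base (phi v))) -thnn_rel// !mulgA.
- move=> /IH oW; under eq_set do rewrite mulgA.
  set W' := [set x | W (x * h)%g] in oW; rewrite open_thnn => g.
  apply: (transl setT) => u Wu.
  exists (O `&` phi @^-1` [set v | W' (g * base u * (gen t)^-1 * base v)%g]).
  split.
  + have := oW (g * base u * (gen t)^-1)%g.
    move/continuousP: phi_cont => /[apply].
    by rewrite open_setSI.
  + by split=> //=; rewrite phi1 base1 mulg1.
  + move=> v [Ov Wv] /=; rewrite thnn_baseM -!mulgA.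
    by rewrite (mulgA (base v)) thnn_relV// !mulgA.
Qed.

Lemma thnn_base_continuous : continuous base.
Proof.
apply/continuousP => W /(_ 1%g).
by under eq_set do rewrite mul1g.
Qed.

Lemma thnn_base_open V : open V -> open (base @` V).
Proof.
move=> oV; rewrite open_thnn => g; apply/open_nbhsP => u [v Vv gu].
have gE : g = (base v * (base u)^-1)%g by rewrite gu mulgK.
apply: (@filterS _ _ _ [set x | V (v * u^-1 * x)%g]) => [x /= Vx|].
  by exists (v * u^-1 * x)%g => //; rewrite !thnn_baseM baseV gE.
apply: open_nbhs_nbhs; split; first exact: open_mulgl.
by rewrite /= mulgVK.
Qed.

Lemma thnn_topologyP : group_topology H.
Proof.
have nbhs_base (x : H) W : nbhs x W <->
    exists V, [/\ open V, V 1%g & forall v, V v -> W (x * base v)%g].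
  rewrite nbhsE; split=> [[B [oB Bx] BW]|[V [oV V1 VW]]].
    exists [set u | B (x * base u)%g]; split; first exact: oB.
      by rewrite /= base1 mulg1.
    by move=> v /BW.
  exists [set y | (base @` V) (x^-1 * y)%g] => [|y [v Vv vE]].
    split; first exact/open_left/thnn_base_open.
    by exists 1%g => //; rewrite base1 mulVg.
  by have := VW v Vv; rewrite vE mulgA mulgV mul1g.
apply/group_topologyE; split=> [x y W /nbhs_base[V [oV V1 VW]]|x W].
  have [A [B [nA nB AB]]] : exists A B : set U,
      [/\ nbhs 1%g A, nbhs 1%g B & forall a b, A a -> B b -> V (a * b)%g].
    case/group_topologyE: gtU => + _; apply.
    by rewrite mulg1; exact: open_nbhs_nbhs.
  move: nA; rewrite {1}nbhsE => -[A' [oA A1] sA].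
  move: nB; rewrite {1}nbhsE => -[B' [oB B1] sB].
  exists [set z | (base @` A') ((x * y)^-1 * (z * y))%g].
  exists [set z | (base @` B') (y^-1 * z)%g]; split.
  - apply: open_nbhs_nbhs; split.
      apply: (@open_right [set z | (base @` A') ((x * y)^-1 * z)%g]).
      exact/open_left/thnn_base_open.
    by exists 1%g => //; rewrite base1 mulVg.
  - apply: open_nbhs_nbhs; split; first exact/open_left/thnn_base_open.
    by exists 1%g => //; rewrite base1 mulVg.
  - move=> a b [u Au uE] [v Bv vE].
    have := VW _ (AB u v (sA _ Au) (sB _ Bv)).
    by rewrite thnn_baseM uE vE -(mulgA _ (a * y)%g) mulVKg mulgA mulgK.
rewrite nbhsE => -[B [oB Bx] BW].
apply: (@filterS _ _ _ [set a | B (a^-1)%g]) => [a /BW//|].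
apply: open_nbhs_nbhs; split=> //; rewrite open_thnn => g.
have := open_right (g^-1)%g oB.
move=> /(_ 1%g) oB'.
apply/open_nbhsP => u /= Bu.
have [_ invC] := (group_topologyE U).1 gtU.
have : nbhs (u^-1)%g [set v | B (base v * g^-1)%g].
  apply: open_nbhs_nbhs; split.
    by move: oB'; under eq_set do rewrite mul1g.
  by rewrite /= baseV -invgM.
by move=> /invC; apply: filterS => v /=; rewrite baseV -invgM.
Qed.

(** Uniqueness: [T] is any group topology on the abstract group [thnn]. *)
Lemma thnn_topology_unique (T : preTopologicalGroupType) (f : H -> T) :
  bijective f -> {morph f : x y / (x * y)%g} -> group_topology T ->
  continuous (f \o base) -> (forall V, open V -> open ((f \o base) @` V)) ->
  forall W : set H, open W <-> open (f @` W).
Proof.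
move=> [f' fK f'K] fM gtT fC fO W; split=> [oW|oW].
  apply/open_nbhsP => _ [x Wx <-].
  apply: (@filterS _ _ _
    [set y | ((f \o base) @` [set u | W (x * base u)%g]) ((f x)^-1 * y)%g]).
    move=> y /= [u /= Wu uE]; exists (x * base u)%g => //.
    by rewrite fM uE mulgA mulgV mul1g.
  apply: open_nbhs_nbhs; split.
    by apply: open_mulgl => //; apply: fO; exact: oW.
  rewrite /= mulVg; exists 1%g; rewrite /= base1 ?mulg1//.
  by apply: (@mulgI _ (f 1%g)); rewrite -fM !mulg1.
rewrite open_thnn => g.
have := open_mulgl gtT (f g) oW.
move/continuousP: fC => /[apply]; congr open.
apply/seteqP; split=> u /=; rewrite -fM; last by exists (g * base u)%g.
by move=> [y Wy /(can_inj fK) <-].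
Qed.

Lemma traag_topologyP : group_topology (traag e O phi).
Proof. exact: (quotgrp_topologyP thnn_topologyP). Qed.

Lemma raag_to_traagE (a : freegrp S) :
  raag_to_traag O phi (quotgrp_pi (raag_rels e) a) =
  quotgrp_pi (@traag_rels S e U O phi) (thnn_free O phi a).
Proof.
apply/quotgrp_eq; set b := quotgrp_repr _.
have /quotgrp_eq : quotgrp_pi (raag_rels e) b = quotgrp_pi (raag_rels e) a.
  by rewrite quotgrp_reprK.
have freeV (x : freegrp S) :
    thnn_free O phi (x^-1)%g = ((thnn_free O phi x)^-1)%g.
  by apply/esym/mulg1_eq; rewrite -thnn_freeM mulgV; exact: free1.
rewrite -freeV -thnn_freeM.
have [[N1 NM NV] NJ] := normal_closure_normal (@traag_rels S e U O phi).
suff /(_ (b^-1 * a)%g) : normal_closure (raag_rels e) `<=`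
  [set x | normal_closure (@traag_rels S e U O phi) (thnn_free O phi x)] by [].
apply: smallest_sub => [|_ [s [t [st ->]]] /=]; last first.
  by apply: sub_normal_closure; exists s, t; rewrite !thnn_freeM !freeV.
split; first split=> [|x y|x] /=.
- by rewrite [thnn_free _ _ _]free1.
- by rewrite thnn_freeM; exact: NM.
- by rewrite freeV; exact: NV.
- move=> x g /= /(NJ _ (thnn_free O phi g)).
  by rewrite !conjgE !thnn_freeM freeV.
Qed.

End TopologicalRAAGTheory.

Record graph (V : Type) := Graph { gvert : set V; gedge : set (set V) }.

Section Graphs.
Context (V : Type) (X : graph V).

Definition simplicial_graph : Prop :=
  gedge X `<=`
  [set E | exists v w, [/\ gvert X v, gvert X w, v <> w & E = [set v; w]]].

Definition locally_finite_graph : Prop :=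
  forall v, gvert X v -> finite_set [set E | gedge X E /\ E v].

Definition adjacent (v w : V) : Prop := exists E, [/\ gedge X E, E v & E w].

Definition connected_graph : Prop := gvert X !=set0 /\
  forall v w, gvert X v -> gvert X w -> clos_refl_trans V adjacent v w.

Record cayley_abels (G : preTopologicalGroupType) (act : G -> V -> V) : Prop :=
  CayleyAbels {
    ca_simplicial : simplicial_graph;
    ca_locally_finite : locally_finite_graph;
    ca_connected : connected_graph;
    ca_act1 : forall v, gvert X v -> act 1%g v = v;
    ca_actM : forall g h v, gvert X v -> act (g * h)%g v = act g (act h v);
    ca_vert : forall g v, gvert X v -> gvert X (act g v);
    ca_edge : forall g E, gedge X E -> gedge X (act g @` E);
    ca_transitive : forall v w, gvert X v -> gvert X w -> exists g, act g v = w;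
    ca_stab_compact : forall v, gvert X v -> compact [set g | act g v = v];
    ca_stab_open : forall v, gvert X v -> open [set g | act g v = v]
  }.

End Graphs.

(** A cubing is a family of cubes whose corners are labelled by vertices. The
   cube with index [c] has one coordinate direction for each element of
   [axes c]; it is realised inside the standard cube [0,1]^I, and for
   [D \subset axes c] the point with coordinates the indicator function of [D]
   is its corner labelled [corner c D]. *)
Record cubing (I : finType) := Cubing {
  cvertex : Type;
  cell : choiceType;
  axes : cell -> {set I};
  corner : cell -> {set I} -> cvertex
}.

Section Cubings.
Context (I : finType) (X : cubing I).

(** The vertices of the face of [c] with directions [T] and origin at the
   corner [D]. *)
Definition face_vertices (c : cell X) (D T : {set I}) : set (cvertex X) :=
  [set corner c (D :|: D') | D' in [set D' : {set I} | D' \subset T]].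

Definition cell_vertices (c : cell X) : set (cvertex X) :=
  face_vertices c finset.set0 (axes c).

Definition skeleton1 : graph (cvertex X) := {|
  gvert := [set v | exists c, cell_vertices c v];
  gedge := [set E | exists c : cell X, #|axes c| = 1%N /\ E = cell_vertices c]
|}.

Definition has_dim (d : nat) : Prop :=
  (forall c : cell X, (#|axes c| <= d)%N) /\ exists c : cell X, #|axes c| = d.

End Cubings.

Local Open Scope ring_scope.

Section Cube.
Context (R : realType) (I : finType).
Implicit Types x y : {ffun I -> R}.

Definition in_cube (T : {set I}) x : bool :=
  [forall i, if i \in T then 0 <= x i <= 1 else x i == 0].

(** The smallest face of the cube on [T] containing [x]. *)
Definition support_face (T : {set I}) x : set {ffun I -> R} :=
  [set y | in_cube T y /\
           forall i, (x i = 0 -> y i = 0) /\ (x i = 1 -> y i = 1)].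

Definition eucl x y : R := Num.sqrt (\sum_i (x i - y i) ^+ 2).

Definition isometry_on (A : set {ffun I -> R}) (h : {ffun I -> R} -> {ffun I -> R}) :=
  forall x y, A x -> A y -> eucl (h x) (h y) = eucl x y.

End Cube.

Section Realization.
Context (R : realType) (I : finType) (X : cubing I).

Definition cube_point : Type :=
  {p : cell X * {ffun I -> R} | in_cube (axes p.1) p.2}.
HB.instance Definition _ := Choice.on cube_point.

Definition pcell (p : cube_point) : cell X := (val p).1.
Definition pcoord (p : cube_point) : {ffun I -> R} := (val p).2.

(** The cube of [p] is glued along the face with origin [D] of the cube of [q]
   having the same directions and the same vertex set. For [D = set0] and equal
   sets of directions this identifies two cubes with the same vertex set. *)
Definition glue_step (p q : cube_point) : Prop := exists D : {set I},
  [/\ axes (pcell p) \subset axes (pcell q),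
      D \subset axes (pcell q) :\: axes (pcell p),
      cell_vertices (pcell p) = face_vertices (pcell q) D (axes (pcell p))
    & forall i, pcoord q i = pcoord p i + (i \in D)%:R].

Definition glue (p q : cube_point) : bool :=
  `[< clos_refl_sym_trans cube_point glue_step p q >].

Let glue_refl : ssrbool.reflexive glue.
Proof. by move=> p; apply/asboolP; exact: rst_refl. Qed.
Let glue_sym : ssrbool.symmetric glue.
Proof. by move=> p q; apply/asboolP/asboolP; exact: rst_sym. Qed.
Let glue_trans : ssrbool.transitive glue.
Proof.
by move=> q p r /asboolP pq /asboolP qr; apply/asboolP; exact: rst_trans pq qr.
Qed.

Canonical glue_equiv := EquivRel glue glue_refl glue_sym glue_trans.

Definition realization : Type := {eq_quot glue_equiv}%qT.
HB.instance Definition _ := Choice.on realization.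

Definition cproj (p : cube_point) : realization :=
  (\pi_({eq_quot glue_equiv}) p)%qT.

(** Bridson--Haefliger, Definition I.7.37, with unit cubes as cells. *)
Definition is_cubed_complex : Prop :=
  (forall p q : cube_point, pcell p = pcell q ->
     (forall i, (pcoord p i == 0) = (pcoord q i == 0) /\
                (pcoord p i == 1) = (pcoord q i == 1)) ->
     cproj p = cproj q -> p = q) /\
  (forall p q : cube_point, cproj p = cproj q ->
     exists h : {ffun I -> R} -> {ffun I -> R},
       [/\ set_bij (support_face (axes (pcell p)) (pcoord p))
                   (support_face (axes (pcell q)) (pcoord q)) h,
           isometry_on (support_face (axes (pcell p)) (pcoord p)) h
         & forall p' q' : cube_point, pcell p' = pcell p -> pcell q' = pcell q ->
             support_face (axes (pcell p)) (pcoord p) (pcoord p') ->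
             pcoord q' = h (pcoord p') -> cproj p' = cproj q']).

(** [segstring x y l]: there is a string of straight segments, each contained in
   a single cube, of total length [l] from [x] to [y]. *)
Inductive segstring (x : realization) : realization -> R -> Prop :=
| segstring_nil : segstring x x 0
| segstring_rcons l p q : segstring x (cproj p) l -> pcell p = pcell q ->
    segstring x (cproj q) (l + eucl (pcoord p) (pcoord q)).

Definition length_dist (x y : realization) : \bar R :=
  ereal_inf [set l%:E | l in segstring x y].

End Realization.

Section LengthPseudoMetric.
Context (R : realType) (I : finType) (X : cubing I).
Local Notation K := (realization R X).

Lemma eucl_ge0 (x y : {ffun I -> R}) : 0 <= eucl x y.
Proof. exact: sqrtr_ge0. Qed.

Lemma eucl_sym (x y : {ffun I -> R}) : eucl x y = eucl y x.
Proof.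
by congr Num.sqrt; apply: eq_bigr => i _; rewrite -sqrrN opprB.
Qed.

Lemma segstring_ge0 (x y : K) l : segstring x y l -> 0 <= l.
Proof. by elim=> // {}l p q _ l0 _; exact: addr_ge0 l0 (eucl_ge0 _ _). Qed.

Lemma segstring_cat (x y z : K) l m :
  segstring x y l -> segstring y z m -> segstring x z (l + m).
Proof.
move=> xy; elim=> [|{}m p q _ IH pq]; first by rewrite addr0.
by rewrite addrA; exact: segstring_rcons.
Qed.

Lemma segstring_sym (x y : K) l : segstring x y l -> segstring y x l.
Proof.
elim=> [|{}l p q _ IH pq]; first exact: segstring_nil.
rewrite addrC eucl_sym; apply: segstring_cat IH.
rewrite -[eucl _ _]add0r; apply: segstring_rcons => //; exact: segstring_nil.
Qed.

Definition length_ball (x : K) (r : R) (y : K) : Prop :=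
  (length_dist x y < r%:E)%E.

Lemma length_ballP (x y : K) r :
  length_ball x r y <-> exists2 l, segstring x y l & l < r.
Proof.
split=> [/ereal_inf_lt[_ [l xy <-]]|[l xy lr]].
  by rewrite lte_fin; exists l.
apply: le_lt_trans (_ : (l%:E < r%:E)%E); last by rewrite lte_fin.
by apply: ereal_inf_lbound; exists l.
Qed.

Let ball_center (x : K) r : 0 < r -> length_ball x r x.
Proof. by move=> r0; apply/length_ballP; exists 0 => //; exact: segstring_nil. Qed.

Let ball_sym (x y : K) r : length_ball x r y -> length_ball y r x.
Proof.
by move=> /length_ballP[l xy lr]; apply/length_ballP; exists l => //;
   exact: segstring_sym.
Qed.

Let ball_triangle (x y z : K) r s :
  length_ball x r y -> length_ball y s z -> length_ball x (r + s) z.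
Proof.
move=> /length_ballP[l xy lr] /length_ballP[m yz ms]; apply/length_ballP.
by exists (l + m); [exact: segstring_cat xy yz|exact: ltrD].
Qed.

Definition length_entourage : set_system (K * K) := entourage_ length_ball.

HB.instance Definition _ := hasNbhs.Build K (nbhs_ length_entourage).
HB.instance Definition _ := @Nbhs_isPseudoMetric.Build R K
  length_entourage erefl length_ball ball_center ball_sym ball_triangle erefl.

End LengthPseudoMetric.

Section MetricNotions.
Context (R : realType).

Definition is_metric (T : Type) (d : T -> T -> \bar R) : Prop :=
  [/\ forall x y, d x y \is a fin_num /\ (0 <= d x y)%E,
      forall x y, d x y = 0%E <-> x = y,
      forall x y, d x y = d y x
    & forall x y z, (d x z <= d x y + d y z)%E].

Definition is_geodesic (T : Type) (d : T -> T -> \bar R) : Prop :=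
  forall x y, exists (l : R) (c : R -> T),
    [/\ 0 <= l, c 0 = x, c l = y
      & forall s t, 0 <= s <= l -> 0 <= t <= l -> d (c s) (c t) = `|s - t|%:E].

Definition is_complete (T : uniformType) : Prop :=
  forall F : set_system T, ProperFilter F -> cauchy F ->
  exists x : T, F --> x.

Definition path_connected (T : topologicalType) : Prop :=
  forall x y : T, exists c : R -> T,
    [/\ {within `[0, 1], continuous c}, c 0 = x & c 1 = y].

End MetricNotions.

(** An injective map carrying every cube isometrically onto a cube. *)
Definition is_cubed_embedding (R : realType) (I : finType) (X Y : cubing I)
    (f : realization R X -> realization R Y) : Prop :=
  injective f /\
  forall c : cell X, exists (c' : cell Y) (h : {ffun I -> R} -> {ffun I -> R}),
    [/\ set_bij [set x | in_cube (axes c) x] [set x | in_cube (axes c') x] h,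
        isometry_on [set x | in_cube (axes c) x] h
      & forall p : cube_point R X, pcell p = c ->
          exists q : cube_point R Y,
            [/\ pcell q = c', pcoord q = h (pcoord p) & f (cproj p) = cproj q]].

Section Salvetti.
Context (S : finType) (e : rel S).

Definition clique (T : {set S}) : bool :=
  [forall s in T, forall t in T, (s != t) ==> e s t].

(** The maximum ranges over the empty set and the sets spanning a clique. *)
Definition clique_dim : nat := \max_(T : {set S} | clique T) #|T|.

(** For [G] a group, [K] a subgroup and [j] mapping adjacent vertices to
   commuting elements. The cell [(g, T)] is the cube [g Q_T]. *)
Definition salvetti (G : groupType) (K : set G) (j : S -> G) : cubing S := {|
  cvertex := set G;
  cell := {c : G * {set S} | clique c.2};
  axes := fun c => (val c).2;
  corner := fun c D => lcoset K ((val c).1 * \prod_(t in D) j t)%g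
|}.

Lemma clique0 : clique finset.set0.
Proof. by apply/forallP => s; rewrite finset.in_set0. Qed.

Lemma in_cube0 (R : realType) (T : {set S}) : in_cube T [ffun=> 0 : R].
Proof.
by apply/forallP => i; rewrite ffunE lexx ler01; case: ifP.
Qed.

Definition salvetti_vertex (R : realType) (G : groupType) (K : set G)
    (j : S -> G) (g : G) : realization R (salvetti K j) :=
  let c : cell (salvetti K j) := exist _ (g, finset.set0) clique0 in
  cproj (exist _ (c, [ffun=> 0]) (in_cube0 R (axes c)) : cube_point R (salvetti K j)).

End Salvetti.

Definition salvetti_raag (S : finType) (e : rel S) : cubing S :=
  salvetti e [set 1%g : raag e] (@raag_gen S e).

Definition salvetti_traag (S : finType) (e : rel S) (U : topologicalGroupType)
    (O : set U) (phi : U -> U) : cubing S :=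
  salvetti e (range (@traag_base S e U O phi)) (@traag_gen S e U O phi).

(* Main.v *)
(** Exponent sums give a homomorphism [chi] from the group to [Z^S] that kills
    [U]; hence every cell is isometrically embedded in [R^S] by a height
    function that is compatible with the gluing, and a point is determined by
    its height together with the vertices of its support face.  A point can
    therefore be moved inside its support face by prescribing its new height,
    and two points in a common cell remain in a common cell.  All metric
    statements follow from this.  Short strings of segments stay in an open star
    and a Cauchy filter, moved to its limit height, becomes constant.  For
    geodesics one takes the ultrafilter limit of the heights of almost shortest
    paths; moving the points of one of these paths to the limit heights gives a
    string of minimal length, although the complex need not be locally compact.

    The embedding of the universal Salvetti complex comes from the retraction of
    [A_Gamma(phi)] onto [A_Gamma].  The criterion for local finiteness rests
    on the intersections of [U] with [t U t^-1] and with [t^-1 U t] being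
    [phi(O)] and [O]; they are read off an explicit permutation representation
    of an HNN extension with a single stable letter, onto which every [t] is
    mapped. *)

Require Import Defs.
From Stdlib Require Import Relations.
From HB Require Import structures.
From mathcomp Require Import all_boot all_order all_algebra.
From mathcomp Require Import all_classical all_reals.
From mathcomp Require Import topology normedtype ereal.
From mathcomp Require Import ring lra zify.

Set Implicit Arguments.
Unset Strict Implicit.
Unset Printing Implicit Defensive.

Import Order.TTheory GRing.Theory Num.Theory numFieldNormedType.Exports.

Local Open Scope classical_set_scope.

(** * Homomorphisms and universal properties of presented groups *)

Section GroupMorphisms.
Local Open Scope group_scope.
Context (G H : groupType) (f : G -> H).
Hypothesis fM : {morph f : x y / x * y}.

Lemma morphism1 : f 1 = 1.
Proof. by apply: (@mulgI _ (f 1)); rewrite -fM !mulg1. Qed.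

Lemma morphismV x : f x^-1 = (f x)^-1.
Proof. by apply/esym/mulg1_eq; rewrite -fM mulgV morphism1. Qed.

Lemma morphism_prod (I : Type) (r : seq I) (P : pred I) (F : I -> G) :
  f (\prod_(i <- r | P i) F i) = \prod_(i <- r | P i) f (F i).
Proof. exact: (big_morph f fM morphism1). Qed.

End GroupMorphisms.

Section Universal.
Local Open Scope group_scope.

(** The kernel of [f] is a normal subgroup containing [R], hence contains the normal closure; so [f]
    may be evaluated on chosen representatives. *)
Lemma quotgrp_lift (G H : groupType) (R : set G) (f : G -> H) :
  {morph f : x y / x * y} -> (forall x, R x -> f x = 1) ->
  exists F : quotgrp R -> H, {morph F : x y / x * y} /\
    forall x, F (quotgrp_pi R x) = f x.
Proof.
move=> fM fR.
have kerf : normal_closure R `<=` [set x | f x = 1].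
  apply: smallest_sub => [|x /fR//]; split; first split.
  - exact: morphism1.
  - by move=> x y /= fx fy; rewrite fM fx fy mulg1.
  - by move=> x /= fx; rewrite morphismV// fx invg1.
  - by move=> x g /= fx; rewrite conjgE !fM fx mul1g morphismV// mulVg.
have fE x : f (quotgrp_repr (quotgrp_pi R x)) = f x.
  have /quotgrp_eq/kerf/= : quotgrp_pi R (quotgrp_repr (quotgrp_pi R x)) =
    quotgrp_pi R x by rewrite quotgrp_reprK.
  by rewrite fM morphismV// => /mulg1_eq; rewrite invgK.
exists (f \o @quotgrp_repr _ R); split=> [x y|//].
rewrite -[x]quotgrp_reprK -[y]quotgrp_reprK -quotgrp_piM /=.
by rewrite !fE fM.
Qed.

(** The product of the letter values is invariant under every elementary step between words, so any
    representative of a class computes it. *)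
Lemma wordgrp_lift (X : choiceType) (i : X -> X)
    (r : seq X -> seq X -> Prop) (H : groupType) (f : X -> H) :
  (forall x, f (i x) = (f x)^-1) ->
  (forall a b, r a b -> \prod_(x <- a) f x = \prod_(x <- b) f x) ->
  exists F : wordgrp i r -> H, {morph F : x y / x * y} /\
    forall a, F (wordgrp_pi i r a) = \prod_(x <- a) f x.
Proof.
move=> fi fr; pose F (x : wordgrp i r) := \prod_(x <- wordgrp_repr x) f x.
have FE a : F (wordgrp_pi i r a) = \prod_(x <- a) f x.
  have : wordgrp_pi i r (wordgrp_repr (wordgrp_pi i r a)) = wordgrp_pi i r a.
    exact: wordgrp_reprK.
  move=> /wordgrp_eq; rewrite /F; move: (wordgrp_repr _) => b.
  elim=> {a b}[_ _ [u v a b /fr ab|u v x|u v x]|//|a b _ ->//|a b c _ -> _ ->//].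
  - by rewrite !big_cat/= ab.
  - by rewrite !big_cat/= big_cons big_seq1 fi mulVg mul1g.
  - by rewrite !big_cat/= big_cons big_seq1 fi mulgV mul1g.
exists F; split=> // x y.
by rewrite -[x]wordgrp_reprK -[y]wordgrp_reprK -wordgrp_piM !FE big_cat.
Qed.

Lemma freegrp_lift (S : choiceType) (H : groupType) (c : S -> H) :
  exists F : freegrp S -> H, {morph F : x y / x * y} /\
    forall s, F (freegen s) = c s.
Proof.
have [|//|F [FM FE]] := @wordgrp_lift (S * bool)%type
  (fun x => (x.1, ~~ x.2)) (fun _ _ => False) H
  (fun x => if x.2 then c x.1 else (c x.1)^-1).
  by move=> [s []]; rewrite //= invgK.
by exists F; split=> // s; rewrite /freegen FE big_seq1.
Qed.

Lemma freegrp_ind (S : choiceType) (P : freegrp S -> Prop) :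
  P 1 -> (forall s x, P x -> P (freegen s * x)) ->
  (forall s x, P x -> P ((freegen s)^-1 * x)) -> forall x, P x.
Proof.
move=> P1 Pg PV x; rewrite -[x]wordgrp_reprK.
elim: (wordgrp_repr x) => [//|[s b] w IHw].
rewrite (wordgrp_piM _ _ [:: (s, b)] w); case: b; first exact: Pg.
have -> : wordgrp_pi _ _ [:: (s, false)] = (freegen s)^-1 :> freegrp S.
  apply/esym/mulg1_eq; rewrite /freegen -wordgrp_piM.
  apply/wordgrp_eq; apply: rst_step.
  exact: (@word_step_Vr _ _ _ [::] [::] (s, true)).
exact: PV.
Qed.

Lemma freeprod_lift (G1 G2 H : groupType) (f1 : G1 -> H) (f2 : G2 -> H) :
  {morph f1 : x y / x * y} -> {morph f2 : x y / x * y} ->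
  exists F : freeprod G1 G2 -> H, [/\ {morph F : x y / x * y},
    forall x, F (freeprodl x) = f1 x & forall x, F (freeprodr x) = f2 x].
Proof.
move=> f1M f2M.
have [||F [FM FE]] := @wordgrp_lift (G1 + G2)%type (@freeprod_inv G1 G2)
  (@freeprod_rel G1 G2) H (fun x => match x with inl x => f1 x | inr x => f2 x end).
- by case=> x /=; rewrite morphismV.
- by move=> _ _ [] x y; rewrite big_cons !big_seq1 (f1M, f2M).
by exists F; split=> // x; rewrite /freeprodl /freeprodr FE big_seq1.
Qed.

Lemma commutator_eq1 (G : groupType) (x y : G) :
  x * y = y * x -> x * y * x^-1 * y^-1 = 1.
Proof. by move=> ->; rewrite mulgK mulgV. Qed.

(** Conjugating the commutator by [y * x] turns it into [(y * x)^-1 * (x * y)], which is the form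
    tested by [quotgrp_eq]. *)
Lemma quotgrp_piC (G : groupType) (R : set G) (x y : G) :
  R (x * y * x^-1 * y^-1) ->
  quotgrp_pi R x * quotgrp_pi R y = quotgrp_pi R y * quotgrp_pi R x.
Proof.
move=> /sub_normal_closure Nxy; rewrite -!quotgrp_piM; apply/esym/quotgrp_eq.
have [_ /(_ _ (y * x) Nxy)] := normal_closure_normal R.
by rewrite conjgE !invgM !mulgA !mulgVK.
Qed.

End Universal.

(** * Homomorphisms out of the topological RAAG and the retraction onto the abstract one *)

Section TraagLift.
Local Open Scope group_scope.
Context (S : finType) (e : rel S) (U : topologicalGroupType).
Context (O : set U) (phi : U -> U).

(** The universal property of the presentation, obtained by lifting in turn over the free group, the
    free product, the HNN relators and the commutators. *)
Lemma traag_lift (H : groupType) (f : U -> H) (c : S -> H) :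
  {morph f : x y / x * y} ->
  (forall t w, O w -> c t * f w = f (phi w) * c t) ->
  (forall s t, e s t -> c s * c t = c t * c s) ->
  exists F : traag e O phi -> H, [/\ {morph F : x y / x * y},
    forall u, F (@traag_base S e U O phi u) = f u &
    forall t, F (@traag_gen S e U O phi t) = c t].
Proof.
move=> fM cf cC; have [g [gM gE]] := freegrp_lift c.
have [h [hM hl hr]] := freeprod_lift fM gM.
have [|h' [h'M h'E]] := @quotgrp_lift _ _ (@thnn_rels S U O phi) h hM.
  move=> _ [t [w [Ow ->]]]; rewrite !hM !(morphismV hM) hl !hr hl gE cf//.
  by rewrite mulgK mulgV.
have h'g t : h' (@thnn_gen S U O phi t) = c t.
  by rewrite /thnn_gen /thnn_free h'E hr gE.
have [|F [FM FE]] := @quotgrp_lift _ _ (@traag_rels S e U O phi) h' h'M.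
  move=> _ [s [t [/cC st ->]]]; rewrite !h'M !(morphismV h'M) !h'g.
  exact: commutator_eq1.
exists F; split=> // [u|t]; first by rewrite /traag_base FE h'E hl.
by rewrite /traag_gen FE h'g.
Qed.

Local Notation base := (@traag_base S e U O phi).
Local Notation gen := (@traag_gen S e U O phi).

Lemma traag_baseM : {morph base : x y / x * y}.
Proof. by move=> x y; rewrite /traag_base thnn_baseM quotgrp_piM. Qed.

Lemma traag_genC s t : e s t -> gen s * gen t = gen t * gen s.
Proof. by move=> st; apply: quotgrp_piC; exists s, t. Qed.

Lemma raag_genC s t : e s t ->
  raag_gen e s * raag_gen e t = raag_gen e t * raag_gen e s.
Proof. by move=> st; apply: quotgrp_piC; exists s, t. Qed.

Lemma traag_rel t w : O w -> gen t * base w = base (phi w) * gen t.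
Proof.
move=> Ow; have := congr1 (quotgrp_pi (@traag_rels S e U O phi)) (thnn_rel phi t Ow).
by rewrite !quotgrp_piM.
Qed.

Lemma raag_to_traagM : {morph @raag_to_traag S e U O phi : x y / x * y}.
Proof.
move=> x y; rewrite -[x]quotgrp_reprK -[y]quotgrp_reprK -quotgrp_piM.
by rewrite !raag_to_traagE thnn_freeM quotgrp_piM.
Qed.

Lemma raag_to_traag_gen s : raag_to_traag O phi (raag_gen e s) = gen s.
Proof. by rewrite /raag_gen raag_to_traagE. Qed.

(** Letters are appended on the right, since right multiplication moves along edges of the complex.
    [thnn_ind] adds them on the left, so it is applied to the inverse of [x]. *)
Lemma traag_ind (P : traag e O phi -> Prop) :
  P 1 -> (forall u x, P x -> P (x * base u)) -> (forall t x, P x -> P (x * gen t)) ->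
  (forall t x, P x -> P (x * (gen t)^-1)) -> forall x, P x.
Proof.
move=> P1 Pb Pg PV x; rewrite -[x]invgK -[x^-1]quotgrp_reprK.
have piV (y : thnn S O phi) : quotgrp_pi (@traag_rels S e U O phi) y^-1 =
    (quotgrp_pi (@traag_rels S e U O phi) y)^-1.
  by apply: morphismV; exact: quotgrp_piM.
elim/thnn_ind: (quotgrp_repr _) => [|u y IH|t y IH|t y IH].
- have -> : quotgrp_pi (@traag_rels S e U O phi) 1 = 1 by [].
  by rewrite invg1.
- by rewrite quotgrp_piM invgM; have := Pb u^-1 _ IH; rewrite (morphismV traag_baseM).
- by rewrite quotgrp_piM invgM; exact: PV.
- by rewrite quotgrp_piM invgM piV invgK; exact: Pg.
Qed.

(** Killing [U] and fixing the generators respects all relators. Hence the canonical map is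
    injective and its image meets [U] trivially. *)
Lemma raag_to_traag_retract : exists r : traag e O phi -> raag e,
  [/\ {morph r : x y / x * y}, forall u, r (base u) = 1 &
      forall a, r (raag_to_traag O phi a) = a].
Proof.
have [|||r [rM rb rg]] := @traag_lift (raag e) (fun=> 1) (@raag_gen S e).
- by move=> x y; rewrite mulg1.
- by move=> t w _; rewrite mulg1 mul1g.
- exact: raag_genC.
exists r; split=> // a; rewrite -[a]quotgrp_reprK.
elim/freegrp_ind: (quotgrp_repr a) => [|s x IH|s x IH].
- have -> : quotgrp_pi (raag_rels e) 1 = 1 by [].
  by rewrite (morphism1 raag_to_traagM) (morphism1 rM).
- by rewrite quotgrp_piM raag_to_traagM rM IH raag_to_traag_gen rg.
- rewrite quotgrp_piM raag_to_traagM rM IH.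
  rewrite (morphismV (@quotgrp_piM _ _)) (morphismV raag_to_traagM).
  by rewrite raag_to_traag_gen (morphismV rM) rg.
Qed.

End TraagLift.

(** * Left cosets and exponent sums *)

Section Cosets.
Local Open Scope group_scope.
Context (G : groupType) (K : set G) (K_subgroup : is_subgroup K).

Lemma lcosetP g h : lcoset K g h <-> K (g^-1 * h).
Proof.
split=> [[k Kk <-]|Kgh]; first by rewrite mulKg.
by exists (g^-1 * h) => //; rewrite mulVKg.
Qed.

Lemma lcoset_eq g h : lcoset K g = lcoset K h <-> K (g^-1 * h).
Proof.
have [K1 KM KV] := K_subgroup; split=> [gh|Kgh].
  by apply/lcosetP; rewrite gh; apply/lcosetP; rewrite mulVg.
apply/seteqP; split=> x /lcosetP Kx; apply/lcosetP.
  by have := KM _ _ (KV _ Kgh) Kx; rewrite invgM invgK -mulgA mulVKg.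
by have := KM _ _ Kgh Kx; rewrite -mulgA mulVKg.
Qed.

Lemma lcoset_mul g h : [set g * x | x in lcoset K h] = lcoset K (g * h).
Proof.
apply/seteqP; split=> [_ [_ [k Kk <-] <-]|_ [k Kk <-]].
  by exists k; rewrite // mulgA.
by exists (h * k); [exists k|rewrite mulgA].
Qed.

End Cosets.

(** A separate name for the free abelian group on [S]: addition is registered as its multiplicative
    group law, as [traag_lift] requires. *)
Definition lattice (S : finType) : Type := {ffun S -> int}.

Section Lattice.
Local Open Scope ring_scope.
Context (S : finType).
HB.instance Definition _ := Choice.on (lattice S).
Let mul (x y : lattice S) : lattice S := (x : {ffun S -> int}) + y.
Let inv (x : lattice S) : lattice S := - (x : {ffun S -> int}).
Let mulA : associative mul. Proof. exact: addrA. Qed.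
Let mul1 : left_id (0 : {ffun S -> int}) mul. Proof. exact: add0r. Qed.
Let mulr1 : right_id (0 : {ffun S -> int}) mul. Proof. exact: addr0. Qed.
Let mulV : left_inverse (0 : {ffun S -> int}) inv mul. Proof. exact: addNr. Qed.
Let mulrV : right_inverse (0 : {ffun S -> int}) inv mul. Proof. exact: addrN. Qed.
HB.instance Definition _ := isGroup.Build (lattice S) mulA mul1 mulr1 mulV mulrV.

Definition lattice_gen (t : S) : lattice S := [ffun s => (s == t)%:R].

Lemma lattice_mulE (x y : lattice S) s : (x * y)%g s = x s + y s.
Proof. exact: ffunE. Qed.

Lemma lattice_mulC (x y : lattice S) : (x * y = y * x)%g.
Proof. exact: addrC. Qed.

End Lattice.

(** [chi g] is the exponent-sum vector of [g]: it lets cells and points of the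
   complex be compared inside [R^S]. *)
Record graded (S : finType) (e : rel S) (G : groupType) (K : set G)
    (j : S -> G) (chi : G -> S -> int) : Prop := Graded {
  gradedK : is_subgroup K;
  gradedC : forall s t, e s t -> (j s * j t = j t * j s)%g;
  gradedM : forall x y s, chi (x * y)%g s = (chi x s + chi y s)%R;
  graded0 : forall k s, K k -> chi k s = 0%R;
  gradedj : forall t s, chi (j t) s = (s == t)%:R%R
}.

(** Send [U] to the neutral element and each generator to its basis vector: the HNN relators become
    trivial and the commutators vanish in an abelian group. *)
Lemma traag_graded (S : finType) (e : rel S) (U : topologicalGroupType)
    (O : set U) (phi : U -> U) : exists chi,
  graded e (range (@traag_base S e U O phi)) (@traag_gen S e U O phi) chi.
Proof.
have [|||F [FM Fb Fg]] :=
    @traag_lift S e U O phi (lattice S) (fun=> 1%g) (@lattice_gen S).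
- by move=> x y; rewrite mulg1.
- by move=> t w _; rewrite mulg1 mul1g.
- by move=> s t _; rewrite lattice_mulC.
exists (fun g s => F g s); split.
- have bM := @traag_baseM S e U O phi; split.
  + by exists 1%g => //; rewrite (morphism1 bM).
  + by move=> _ _ [u _ <-] [v _ <-]; exists (u * v)%g.
  + by move=> _ [u _ <-]; exists (u^-1)%g; rewrite ?(morphismV bM).
- exact: traag_genC.
- by move=> x y s; rewrite FM lattice_mulE.
- by move=> _ s [u _ <-]; rewrite Fb ffunE.
- by move=> t s; rewrite Fg ffunE.
Qed.

(** * Conjugation of the base group by the stable letters *)

Section SymmetricGroup.
Local Open Scope group_scope.
Context (T : choiceType).

(** A permutation is stored together with its inverse, so that inversion is an exchange of the two
    components. *)
Definition symgrp : Type :=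
  {f : (T -> T) * (T -> T) | `[< cancel f.1 f.2 /\ cancel f.2 f.1 >]}.
HB.instance Definition _ := Choice.on symgrp.

Definition symfun (f : symgrp) : T -> T := (val f).1.

Lemma sym_of_subproof (f g : T -> T) : cancel f g -> cancel g f ->
  `[< cancel (f, g).1 (f, g).2 /\ cancel (f, g).2 (f, g).1 >].
Proof. by move=> fg gf; apply/asboolP. Qed.

Definition sym_of (f g : T -> T) (fg : cancel f g) (gf : cancel g f) : symgrp :=
  exist _ (f, g) (sym_of_subproof fg gf).

Let symK (f : symgrp) : cancel (val f).1 (val f).2.
Proof. by have /asboolP[] := valP f. Qed.
Let symKV (f : symgrp) : cancel (val f).2 (val f).1.
Proof. by have /asboolP[] := valP f. Qed.

Let mul (f g : symgrp) : symgrp :=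
  sym_of (can_comp (symK f) (symK g)) (can_comp (symKV g) (symKV f)).
Let one : symgrp := @sym_of id id (fun=> erefl) (fun=> erefl).
Let inv (f : symgrp) : symgrp := sym_of (symKV f) (symK f).

Lemma symfun_inj (f g : symgrp) : symfun f =1 symfun g -> f = g.
Proof.
move=> fg; apply: val_inj; rewrite [LHS]surjective_pairing.
rewrite [RHS]surjective_pairing; congr pair; first exact/funext.
apply/funext => x; apply: (can_inj (symK f)).
by rewrite symKV -[LHS](symKV g); apply/esym/fg.
Qed.

Let mulA : associative mul. Proof. by move=> f g h; exact: symfun_inj. Qed.
Let mul1 : left_id one mul. Proof. by move=> f; exact: symfun_inj. Qed.
Let mulr1 : right_id one mul. Proof. by move=> f; exact: symfun_inj. Qed.
Let mulV : left_inverse one inv mul.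
Proof. by move=> f; apply: symfun_inj => x; exact: symK. Qed.
Let mulrV : right_inverse one inv mul.
Proof. by move=> f; apply: symfun_inj => x; exact: symKV. Qed.
HB.instance Definition _ := isGroup.Build symgrp mulA mul1 mulr1 mulV mulrV.

Lemma symfunM (f g : symgrp) x : symfun (f * g) x = symfun f (symfun g x).
Proof. by []. Qed.

End SymmetricGroup.

Section CosetRepresentative.
Local Open Scope group_scope.
Context (G : groupType) (K : set G) (K_subgroup : is_subgroup K).

(** A chosen element of the right coset [K x]; for a subgroup the set is never empty and the default
    1 does not intervene. *)
Definition coset_repr (x : G) : G := xget 1 [set y | K (x * y^-1)].

Lemma coset_reprP x : K (x * (coset_repr x)^-1).
Proof.
by apply: (@xgetPex _ 1 [set y | K (x * y^-1)]); exists x; rewrite /= mulgV;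
  case: K_subgroup.
Qed.

(** [xget] depends only on the set of candidates, and [k * x] and [x] have the same candidates. *)
Lemma coset_reprM k x : K k -> coset_repr (k * x) = coset_repr x.
Proof.
case: K_subgroup => _ KM KV Kk; congr xget; apply/seteqP; split=> y /= Ky.
  by have := KM _ _ (KV _ Kk) Ky; rewrite -mulgA mulKg.
by rewrite -mulgA; exact: KM.
Qed.

Lemma coset_reprK x : coset_repr (coset_repr x) = coset_repr x.
Proof.
have [_ _ KV] := K_subgroup.
have := coset_reprM x (KV _ (coset_reprP x)).
by rewrite invgM invgK mulgVK.
Qed.

Lemma coset_repr_eq x y : coset_repr x = coset_repr y -> K (x * y^-1).
Proof.
have [_ KM KV] := K_subgroup.
move=> xy; have := KM _ _ (coset_reprP x) (KV _ (coset_reprP y)).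
by rewrite invgM invgK xy mulgA mulgVK.
Qed.

End CosetRepresentative.

Section Britton.
Local Open Scope group_scope.
Context (S : finType) (e : rel S) (U : topologicalGroupType).
Context (O : set U) (phi : U -> U).
Hypothesis O_subgroup : is_subgroup O.
Hypothesis phiM : {in O &, {morph phi : x y / x * y}}.
Hypothesis phi_inj : {in O &, injective phi}.

Local Notation P := (phi @` O).

Let phiOM x y : O x -> O y -> phi (x * y) = phi x * phi y.
Proof. by move=> Ox Oy; apply: phiM; rewrite inE. Qed.

Lemma image_subgroup : is_subgroup P.
Proof.
have [O1 OM OV] := O_subgroup.
have phi1 : phi 1 = 1.
  by apply: (@mulgI _ (phi 1)); rewrite -phiOM// !mulg1.
split; first by exists 1.
- by move=> _ _ [x Ox <-] [y Oy <-]; exists (x * y); rewrite ?phiOM//; exact: OM.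
- move=> _ [x Ox <-]; exists x^-1; first exact: OV.
  by apply/esym/mulg1_eq; rewrite -phiOM ?mulgV//; exact: OV.
Qed.

(** The inverse of [phi] on the image [P], with value 1 elsewhere. *)
Let psi v := xget 1 [set w | O w /\ phi w = v].

Let phiK w : O w -> psi (phi w) = w.
Proof.
move=> Ow; apply: xget_unique => // v [Ov vw].
by apply: phi_inj; rewrite ?inE.
Qed.

Let psiK v : P v -> phi (psi v) = v /\ O (psi v).
Proof.
move=> [w Ow wv]; suff [] : [set w | O w /\ phi w = v] (psi v) by [].
by apply: xgetPex; exists w.
Qed.

Let A := {x : U | coset_repr O x == x}.
Let B := {x : U | coset_repr P x == x}.
Let toA (x : U) : A := exist _ (coset_repr O x) (introT eqP (coset_reprK O_subgroup x)).
Let toB (x : U) : B :=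
  exist _ (coset_repr P x) (introT eqP (coset_reprK image_subgroup x)).

Let cons (X : Type) (x : X) (s : nat -> X) n := if n is n'.+1 then s n' else x.
Let tail (X : Type) (s : nat -> X) n := s n.+1.
Let cons_tail (X : Type) (s : nat -> X) : cons (s 0) (tail s) = s.
Proof. by apply/funext => -[]. Qed.

(** [tau] below conjugates the left translation by [w \in O] into the one by
   [phi w]. The infinite sequences of coset representatives absorb the possibly
   different indices of [O] and [phi @` O]. *)
Let T : choiceType := (U * (nat -> A) * (nat -> B))%type.

Let lmul (u : U) (x : T) : T := (u * x.1.1, x.1.2, x.2).

(** Write the first component as [w * r] with [w] in [O] and [r] its chosen representative. Then [r]
    is pushed onto the sequence in [A], and the head of the sequence in [B] is removed and takes its
    place behind [phi w]. *)
Let tau (x : T) : T :=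
  (phi (x.1.1 * (coset_repr O x.1.1)^-1) * val (x.2 0),
   cons (toA x.1.1) x.1.2, tail x.2).
Let tauV (x : T) : T :=
  (psi (x.1.1 * (coset_repr P x.1.1)^-1) * val (x.1.2 0),
   tail x.1.2, cons (toB x.1.1) x.2).

Let tauK : cancel tau tauV.
Proof.
move=> [[u a] b]; rewrite /tau /tauV /=.
have Ow := coset_reprP O_subgroup u.
have -> : coset_repr P (phi (u * (coset_repr O u)^-1) * val (b 0)) = val (b 0).
  rewrite coset_reprM; [exact/eqP/(valP (b 0))|exact: image_subgroup|].
  by exists (u * (coset_repr O u)^-1).
rewrite mulgK phiK// mulgVK; congr (_, _, _).
rewrite -[RHS]cons_tail; congr cons; apply: val_inj => /=.
rewrite coset_reprM; [exact/eqP/(valP (b 0))|exact: image_subgroup|].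
by exists (u * (coset_repr O u)^-1).
Qed.

Let tauVK : cancel tauV tau.
Proof.
move=> [[u a] b]; rewrite /tau /tauV /=.
have [E Ow] := psiK (coset_reprP image_subgroup u).
have rE : coset_repr O (psi (u * (coset_repr P u)^-1) * val (a 0)) = val (a 0).
  rewrite coset_reprM//; exact/eqP/(valP (a 0)).
rewrite rE mulgK E mulgVK; congr (_, _, _).
by rewrite -[RHS]cons_tail; congr cons; apply: val_inj.
Qed.

Let lmulK u : cancel (lmul u) (lmul u^-1).
Proof. by move=> [[v a] b]; rewrite /lmul /= mulKg. Qed.
Let lmulVK u : cancel (lmul u^-1) (lmul u).
Proof. by move=> [[v a] b]; rewrite /lmul /= mulVKg. Qed.

(** Left translation by [w] in [O] changes only the [O]-part of the first component, which [tau]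
    maps by [phi]; this is the HNN relation. All generators act by the same permutation, so the
    commutators act trivially. *)
Let hnn_action : exists F : traag e O phi -> symgrp T,
  [/\ {morph F : x y / x * y},
    forall u, F (@traag_base S e U O phi u) = sym_of (lmulK u) (lmulVK u) &
    forall t, F (@traag_gen S e U O phi t) = sym_of tauK tauVK].
Proof.
apply: traag_lift => [x y|t w Ow|s t _ //].
  by apply: symfun_inj => z; rewrite symfunM /symfun /= /lmul mulgA.
apply: symfun_inj => z; rewrite !symfunM /symfun /= /lmul /tau /=.
rewrite coset_reprM// -mulgA phiOM//; last exact: coset_reprP.
rewrite mulgA; congr (_, cons _ _, _); apply: val_inj => /=.
by rewrite coset_reprM.
Qed.

Let x0 : T := (1, fun=> toA 1, fun=> toB 1).

Lemma traag_base_inj : injective (@traag_base S e U O phi).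
Proof.
move=> u v uv; have [F [_ Fb _]] := hnn_action.
have /(congr1 (fun f => (symfun f x0).1.1)) :=
  etrans (esym (Fb u)) (etrans (congr1 F uv) (Fb v)).
by rewrite /symfun /= !mulg1.
Qed.

(** Apply both sides to [x0]: the head of the sequence in [A] becomes the representative of [O u] on
    the left and that of [O] on the right, because translation by [v] leaves the sequences alone. *)
Lemma traag_conj_base t u v :
  @traag_gen S e U O phi t * @traag_base S e U O phi u =
  @traag_base S e U O phi v * @traag_gen S e U O phi t -> O u.
Proof.
have [F [FM Fb Fg]] := hnn_action.
move=> /(congr1 F); rewrite !FM !Fb !Fg => /(congr1 (fun f => symfun f x0)).
rewrite !symfunM /symfun /= => /(congr1 (fun x => val (x.1.2 0))) /=.
by rewrite /= mulg1 => /(coset_repr_eq O_subgroup); rewrite invg1 mulg1.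
Qed.

(** The same argument for the inverse permutation, reading the head of the sequence in [B]. *)
Lemma traag_conjV_base t u v :
  (@traag_gen S e U O phi t)^-1 * @traag_base S e U O phi u =
  @traag_base S e U O phi v * (@traag_gen S e U O phi t)^-1 -> P u.
Proof.
have [F [FM Fb Fg]] := hnn_action.
move=> /(congr1 F); rewrite !FM (morphismV FM) !Fb !Fg.
move=> /(congr1 (fun f => symfun f x0)).
rewrite !symfunM /symfun /= => /(congr1 (fun x => val (x.2 0))) /=.
by rewrite /= mulg1 => /(coset_repr_eq image_subgroup); rewrite invg1 mulg1.
Qed.

End Britton.

(** * Heights and gluing *)

Section Heights.
Local Open Scope ring_scope.
Context (R : realType) (S : finType) (e : rel S) (G : groupType) (K : set G).
Context (j : S -> G) (chi : G -> S -> int).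
Hypothesis gr : graded e K j chi.

Local Notation X := (salvetti e K j).
Local Notation point := (cube_point R X).
Implicit Types (c : cell X) (p q : point) (D T : {set S}) (g h : G).

Definition cell_origin c : G := (val c).1.
Definition cube_vertex D : G := (\prod_(t in D) j t)%g.

Lemma chi1 s : chi 1%g s = 0.
Proof. by apply: (graded0 gr); case: (gradedK gr). Qed.

Lemma chiV g s : chi g^-1%g s = - chi g s.
Proof. by apply/eqP; rewrite -subr_eq0 opprK -(gradedM gr) mulVg chi1. Qed.

Lemma chi_coset g h s : K (g^-1 * h)%g -> chi h s = chi g s.
Proof.
by move=> Kgh; have := graded0 gr s Kgh; rewrite (gradedM gr) chiV addrC => /subr0_eq.
Qed.

Lemma chi_cube_vertex D s : chi (cube_vertex D) s = (s \in D)%:R.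
Proof.
rewrite /cube_vertex (big_morph (chi^~ s) (fun x y => gradedM gr x y s) (chi1 s)).
under eq_bigr do rewrite (gradedj gr).
have [sD|sD] := boolP (s \in D).
  rewrite (bigD1 s)//= eqxx big1 ?addr0// => t /andP[_ ts].
  by rewrite eq_sym (negbTE ts).
rewrite big1// => t tD; case: eqP => // st.
by rewrite st tD in sD.
Qed.

Lemma cliqueP T : clique e T ->
  forall s t, s \in T -> t \in T -> (j s * j t = j t * j s)%g.
Proof.
move=> /forall_inP cT s t sT tT; have [->//|st] := eqVneq s t.
by apply: (gradedC gr); have /forall_inP/(_ t tT)/implyP := cT s sT; apply.
Qed.

(** Both products follow the order of [r]; a factor from [Q] met on the way is moved past the whole
    product over [P]. *)
Lemma prod_commuting (r : seq S) (P Q : pred S) :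
  (forall s t, Q s -> P t -> (j s * j t = j t * j s)%g) ->
  (forall s, ~~ (P s && Q s)) ->
  (\prod_(t <- r | P t || Q t) j t =
   \prod_(t <- r | P t) j t * \prod_(t <- r | Q t) j t)%g.
Proof.
move=> PQC PQ; elim: r => [|s r IH]; first by rewrite !big_nil mulg1.
rewrite !big_cons IH; have := PQ s.
case Ps: (P s); case Qs: (Q s) => //= _; rewrite ?mulgA//; congr ( *%g).
by apply: commute_prod => t Pt; exact: PQC.
Qed.

Lemma cube_vertexU T D D' : clique e T -> D \subset T -> D' \subset T ->
  D :&: D' = finset.set0 -> cube_vertex (D :|: D') = (cube_vertex D * cube_vertex D')%g.
Proof.
move=> cT /fintype.subsetP DT /fintype.subsetP D'T DD'; rewrite /cube_vertex.
under eq_bigl do rewrite inE.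
apply: prod_commuting => [s t sD tD'|s].
  by apply: (cliqueP cT); [exact: D'T|exact: DT].
by have /setP/(_ s) := DD'; rewrite !inE => ->.
Qed.

(** The union in [G] of the vertex cosets of a face. Equality of vertex sets can then be tested on
    single group elements. *)
Definition face_set c D T : set G :=
  [set g : G | exists2 D' : {set S}, D' \subset T &
    K ((cell_origin c * cube_vertex (D :|: D'))^-1 * g)%g].

Lemma face_setE c D T : face_set c D T = \bigcup_(v in face_vertices c D T) v.
Proof.
apply/seteqP; split=> [g [D' D'T /lcosetP gD']|g [_ [D' D'T <-]] /lcosetP].
  exists (corner c (D :|: D')) => //; exists D' => //.
by exists D'.
Qed.

Lemma face_verticesE c D T : face_vertices c D T = [set lcoset K g | g in face_set c D T].
Proof.
apply/seteqP; split=> [_ [D' D'T <-]|_ [g [D' D'T /(lcoset_eq (gradedK gr)) gD'] <-]].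
  exists (cell_origin c * cube_vertex (D :|: D'))%g => //.
  by exists D' => //; rewrite mulVg; case: (gradedK gr).
by exists D' => //; rewrite -gD'.
Qed.

Lemma face_vertices_eq c D T c' D' T' :
  face_vertices c D T = face_vertices c' D' T' <->
  face_set c D T = face_set c' D' T'.
Proof. by split=> E; [rewrite !face_setE E|rewrite !face_verticesE E]. Qed.

Lemma coord_cube p i : 0 <= pcoord p i <= 1.
Proof.
have /forallP/(_ i) := valP p; case: ifP => // _ /eqP.
by rewrite /pcoord => ->; rewrite lexx ler01.
Qed.

Lemma coord_axes p i : i \notin axes (pcell p) -> pcoord p i = 0.
Proof. by have /forallP/(_ i) := valP p; case: ifP => // _ /eqP. Qed.

Lemma coord_cases p i : [\/ pcoord p i = 0, pcoord p i = 1 | 0 < pcoord p i < 1].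
Proof.
have /andP[] := coord_cube p i.
rewrite le_eqVlt => /predU1P[<- _|x0]; first exact: Or31.
rewrite le_eqVlt => /predU1P[->|x1]; first exact: Or32.
by apply: Or33; rewrite x0.
Qed.

Definition height p : {ffun S -> R} :=
  [ffun s => (chi (cell_origin (pcell p)) s)%:~R + pcoord p s].

(** The smallest face containing [p] has its origin at the corner [ones p] and its directions in
    [inner p]. *)
Definition ones p : {set S} := [set i | pcoord p i == 1]%SET.
Definition inner p : {set S} := [set i | 0 < pcoord p i < 1]%SET.

Lemma ones_axes p : ones p \subset axes (pcell p).
Proof.
apply/fintype.subsetP => i; rewrite inE; apply: contraLR => /coord_axes ->.
by rewrite eq_sym oner_eq0.
Qed.

Lemma inner_axes p : inner p \subset axes (pcell p).
Proof.
by apply/fintype.subsetP => i; rewrite inE; apply: contraLR => /coord_axes ->; rewrite ltxx.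
Qed.

(** The union of the cosets that are the vertices of the smallest face
   containing [p]. *)
Definition carrier p : set G := face_set (pcell p) (ones p) (inner p).

Definition cell_set c : set G := face_set c finset.set0 (axes c).

Lemma chi_face c D T g : face_set c D T g -> exists2 D' : {set S}, D' \subset T &
  forall i, chi g i = chi (cell_origin c) i + (i \in D :|: D')%:R.
Proof.
move=> [D' D'T /chi_coset gE]; exists D' => // i.
by rewrite gE (gradedM gr) chi_cube_vertex.
Qed.

Lemma carrierP p g : carrier p g <->
  cell_set (pcell p) g /\ forall i, `|(chi g i)%:~R - height p i| < 1.
Proof.
split=> [[D DT Kg]|[[E ET Kg] near]].
  split.
    exists (ones p :|: D); last by rewrite finset.set0U.
    by rewrite finset.subUset ones_axes (fintype.subset_trans DT (inner_axes p)).
  move=> i; rewrite (chi_coset _ Kg) (gradedM gr) chi_cube_vertex ffunE.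
  rewrite intrD opprD addrACA subrr add0r inE.
  case: (coord_cases p i) => [xi|xi|/andP[x0 x1]].
  - have -> : (i \in ones p) = false by rewrite inE xi eq_sym oner_eq0.
    have -> : (i \in D) = false.
      by apply/negP => /(fintype.subsetP DT); rewrite inE xi ltxx.
    by rewrite xi subrr normr0 ltr01.
  - by rewrite inE xi eqxx /= subrr normr0 ltr01.
  - case: (_ || _) => /=; first by rewrite ger0_norm ?subr_ge0 ?(ltW x1)// gtrBl.
    by rewrite sub0r normrN gtr0_norm.
(* [E] is the corner whose coset contains [g]; nearness forces it to contain [ones p] and to add
   only directions of [inner p]. *)
have nearE i : `|(i \in E)%:R - pcoord p i| < 1.
  have := near i; rewrite (chi_coset _ Kg) (gradedM gr) chi_cube_vertex ffunE.
  rewrite intrD opprD addrACA subrr add0r finset.set0U.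
  by case: (i \in E).
exists (E :&: inner p); first exact: finset.subsetIr.
suff -> : ones p :|: E :&: inner p = finset.set0 :|: E by [].
apply/setP => i; rewrite !inE; have := nearE i.
case: (coord_cases p i) => [->|->|->]; rewrite ?eqxx ?ltxx ?andbF ?andbT ?orbF.
- by rewrite eq_sym oner_eq0; case: (i \in E); rewrite ?subr0 ?normr1 ?ltxx.
- by case: (i \in E); rewrite ?sub0r ?normrN ?normr1 ?ltxx.
- move=> nE; rewrite orb_idl// => /eqP xi; move: nE; rewrite xi.
  by case: (i \in E); rewrite // sub0r normrN1 ltxx.
Qed.

Lemma glue_step_invariant p q : glue_step p q ->
  height p = height q /\ carrier p = carrier q.
Proof.
case=> D [pq Dq /face_vertices_eq E coordE].
have [K1 _ _] := gradedK gr.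
(* Each of the two origins of the common face is a vertex of the other description. The exponent
   sums then differ by indicator functions in both ways, which forces them to coincide. *)
have : face_set (pcell q) D (axes (pcell p)) (cell_origin (pcell p)).
  rewrite -E; exists finset.set0; first exact: finset.sub0set.
  by rewrite finset.setU0 /cube_vertex big_set0 mulg1 mulVg.
move=> /chi_face[D1 D1p chip].
have : face_set (pcell p) finset.set0 (axes (pcell p))
    (cell_origin (pcell q) * cube_vertex D)%g.
  rewrite E; exists finset.set0; first exact: finset.sub0set.
  by rewrite finset.setU0 mulVg.
move=> /chi_face[D2 D2p chiq].
have DD i : i \in D -> i \notin axes (pcell p).
  by move=> /(fintype.subsetP Dq); rewrite inE => /andP[].
have chiE i : chi (cell_origin (pcell p)) i = chi (cell_origin (pcell q)) i + (i \in D)%:R.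
  have := chiq i; rewrite (gradedM gr) chi_cube_vertex chip finset.set0U inE.
  move=> /eqP; rewrite -addrA (inj_eq (addrI _)) => /eqP.
  by case: (i \in D); case: (i \in D1); case: (i \in D2).
have hE : height p = height q.
  apply/ffunP => i; rewrite !ffunE coordE chiE intrD -!addrA; congr +%R.
  by rewrite addrC; case: (i \in D).
split=> //; apply/seteqP; split=> g /carrierP[cg near]; apply/carrierP.
  split; last by rewrite -hE.
  move: cg; rewrite /cell_set E => -[D' D'p Kg].
  exists (D :|: D'); last by rewrite finset.set0U.
  rewrite finset.subUset (fintype.subset_trans D'p pq) andbT.
  exact: fintype.subset_trans Dq (finset.subsetDl _ _).
split; last by rewrite hE.
rewrite /cell_set E; case: cg => F Fq Kg.
(* Outside the directions of the cube of [p] the coordinates of [q] are the indicator of [D], so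
   nearness makes [F] agree with [D] there. *)
exists (F :&: axes (pcell p)); first exact: finset.subsetIr.
suff -> : D :|: F :&: axes (pcell p) = finset.set0 :|: F by [].
apply/setP => i; rewrite !inE; have := near i.
rewrite (chi_coset _ Kg) (gradedM gr) chi_cube_vertex ffunE finset.set0U.
rewrite intrD opprD addrACA subrr add0r coordE.
have := @coord_axes p i; case: (boolP (i \in axes (pcell p))) => ip.
  by move=> _ _; rewrite andbT orb_idl// => /DD; rewrite ip.
move=> /(_ isT) ->; rewrite andbF orbF add0r.
by case: (i \in D); case: (i \in F); rewrite ?sub0r ?subr0 ?normrN ?normr1 ?ltxx.
Qed.

End Heights.

Section Compatible.
Local Open Scope ring_scope.
Context (R : realType) (S : finType).
Implicit Types h v w : {ffun S -> R}.

(** [v] lies in the closed cell containing [h] in its interior, for the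
   cubulation of [R^S] by integral unit cubes. *)
Definition compat h v := forall i (n : int),
  (n%:~R <= h i -> n%:~R <= v i) /\ (h i <= n%:~R -> v i <= n%:~R).

(** The contrapositive of [compat] at the integers [n - 1] and [n + 1]. *)
Lemma compat_near h v : compat h v ->
  forall i (n : int), `|n%:~R - v i| < 1 -> `|n%:~R - h i| < 1.
Proof.
move=> hv i n; have [+ _] := hv i (n + 1); have [_] := hv i (n - 1).
rewrite !intrD intrN !ltr_norml /= => nl nr /andP[vl vr].
apply/andP; split; rewrite ltNge; apply/negP => hn.
  by have := nr ltac:(lra); lra.
by have := nl ltac:(lra); lra.
Qed.

Lemma int_not_inside (n m : int) (x y : R) :
  0 < x < 1 -> 0 <= y <= 1 -> n%:~R + x = m%:~R + y -> n = m.
Proof.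
move=> /andP[x0 x1] /andP[y0 y1] nm.
have nm1 : (n%:~R : R) < (m + 1)%:~R by rewrite intrD; lra.
have mn1 : (m%:~R : R) < (n + 1)%:~R by rewrite intrD; lra.
by move: nm1 mn1; rewrite !ltr_int !ltzD1 => nm1 mn1; apply/eqP; rewrite eq_le nm1 mn1.
Qed.

End Compatible.

Section Gluing.
Local Open Scope ring_scope.
Context (R : realType) (S : finType) (e : rel S) (G : groupType) (K : set G).
Context (j : S -> G) (chi : G -> S -> int).
Hypothesis gr : graded e K j chi.

Local Notation X := (salvetti e K j).
Local Notation point := (cube_point R X).
Local Notation height := (@height R S e G K j chi).
Local Notation carrier := (@carrier R S e G K j).
Implicit Types (c : cell X) (p q : point) (D T : {set S}) (g : G).
Implicit Types (v : {ffun S -> R}).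

Lemma heightE p i : height p i = (chi (cell_origin (pcell p)) i)%:~R + pcoord p i.
Proof. exact: ffunE. Qed.

Lemma point_eq p q : pcell p = pcell q -> height p = height q -> p = q.
Proof.
move=> pq /ffunP hpq; apply: val_inj; rewrite [LHS]surjective_pairing.
rewrite [RHS]surjective_pairing; congr pair; first exact: pq.
apply/ffunP => i; have := hpq i; rewrite !heightE pq; exact: addrI.
Qed.

Lemma clique_sub T T' : T' \subset T -> clique e T -> clique e T'.
Proof.
move=> /fintype.subsetP TT' /forall_inP cT; apply/forall_inP => s /TT' sT.
by apply/forall_inP => t /TT' tT; have /forall_inP/(_ t tT) := cT s sT.
Qed.

(** The smallest face of the cube containing [p], taken as a cell in its own right. *)
Definition support_cell p : cell X :=
  exist _ ((cell_origin (pcell p) * cube_vertex j (ones p))%g, inner p)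
    (clique_sub (inner_axes p) (valP (pcell p))).

Lemma support_in_cube p : in_cube (axes (support_cell p))
  [ffun i => if i \in inner p then pcoord p i else 0].
Proof.
apply/forallP => i; rewrite ffunE; case: ifP => [pi|]; last first.
  by rewrite [axes _]/= => ->.
by rewrite [_ \in _]pi; exact: coord_cube.
Qed.

Definition support p : point := exist _ (support_cell p, _) (support_in_cube p).

Lemma carrier_support p :
  face_set (support_cell p) finset.set0 (inner p) = carrier p.
Proof.
apply/seteqP; split=> g [D DT Kg]; exists D => //; move: Kg; rewrite finset.set0U.
  rewrite (cube_vertexU gr (valP (pcell p)) (ones_axes p)) ?mulgA//.
    exact: fintype.subset_trans DT (inner_axes p).
  apply/setP => i; rewrite !inE; case: eqP => //= pi.
  by apply/negP => /(fintype.subsetP DT); rewrite inE pi ltxx andbF.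
rewrite (cube_vertexU gr (valP (pcell p)) (ones_axes p)) ?mulgA//.
  exact: fintype.subset_trans DT (inner_axes p).
apply/setP => i; rewrite !inE; case: eqP => //= pi.
by apply/negP => /(fintype.subsetP DT); rewrite inE pi ltxx andbF.
Qed.

(** The inner directions are those in which the height is not an integer. *)
Lemma inner_height p q : height p = height q -> inner p \subset inner q.
Proof.
move=> /ffunP hpq; apply/fintype.subsetP => i; rewrite !inE => pi.
have := hpq i; rewrite !heightE => pq.
have n := int_not_inside pi (coord_cube q i) pq.
by move: pq; rewrite n => /addrI <-.
Qed.

Lemma support_glue p q : height p = height q -> carrier p = carrier q ->
  glue_step (support p) q.
Proof.
move=> hpq cpq; have iE : inner p = inner q.
  by apply/eqP; rewrite finset.eqEsubset !inner_height.
have aE : axes (pcell (support p)) = inner q by rewrite -iE.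
exists (ones q); split.
- by rewrite aE inner_axes.
- rewrite aE finset.subsetD ones_axes finset.disjoints_subset.
  apply/fintype.subsetP => i; rewrite !inE => /eqP ->.
  by rewrite ltxx andbF.
- apply/(face_vertices_eq gr); rewrite aE -iE [LHS]carrier_support cpq.
  by rewrite iE.
- move=> i; rewrite [pcoord (support p) i]ffunE.
  have /ffunP/(_ i) := hpq; rewrite !heightE.
  case: ifP => pi.
    have qi : i \in inner q by rewrite -iE.
    have /negbTE -> : i \notin ones q.
      by move: qi; rewrite !inE => /andP[_ /lt_eqF ->].
    rewrite addr0; move: pi; rewrite inE => pi pq.
    have n := int_not_inside pi (coord_cube q i) pq.
    by move: pq; rewrite n => /addrI.
  move=> _; rewrite add0r !inE; move: pi; rewrite iE inE.
  by case: (coord_cases q i) => [->|->|->//]; rewrite ?eqxx// eq_sym oner_eq0.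
Qed.

(** Height and carrier are complete invariants of a glued point: each gluing step preserves them,
    and if they agree then [support p] is glued to both [p] and [q]. *)
Lemma cproj_eq p q :
  cproj p = cproj q <-> height p = height q /\ carrier p = carrier q.
Proof.
split=> [/eqquotP/asboolP|[hpq cpq]].
  elim=> {p q}[p q /(glue_step_invariant gr)//|//|p q _ [-> ->]//|].
  by move=> p q r _ [-> ->] _ [-> ->].
apply/eqquotP/asboolP; apply: (@rst_trans _ _ _ (support p)).
  by apply: rst_sym; apply: rst_step; exact: support_glue.
by apply: rst_step; exact: support_glue.
Qed.

(** After subtracting the integral origin, [compat] at 0 and 1 gives the cube inequalities and the
    support conditions; all other integers are harmless because the coordinates lie in [0,1]. *)
Lemma support_faceP p (y : {ffun S -> R}) :
  support_face (axes (pcell p)) (pcoord p) y <->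
  compat (height p) [ffun i => (chi (cell_origin (pcell p)) i)%:~R + y i].
Proof.
split=> [[/forallP yc ypi] i n|yp].
  have yi : 0 <= y i <= 1.
    by have := yc i; case: ifP => // _ /eqP ->; rewrite lexx ler01.
  rewrite heightE ffunE; set k := chi _ _.
  have [m ->] : exists m, n = k + m by exists (n - k); rewrite addrC subrK.
  rewrite intrD !lerD2l; have [y0 y1] := ypi i.
  have [m0|m0] := ltP 0 m.
    have m1 : 1 <= (m%:~R : R) by rewrite ler1z; lia.
    by split=> [mx|]; [rewrite y1 ?(le_trans mx)|]; have := coord_cube p i; lra.
  have [m1|m1] := ltP m 0.
    have {}m1 : (m%:~R : R) <= (-1)%:~R by rewrite ler_int; lia.
    rewrite mulrN1z in m1.
    by have := coord_cube p i; split; lra.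
  have -> : m = 0 by lia.
  by split=> [_|x0]; [lra|rewrite y0//]; have := coord_cube p i; lra.
have {}yp i (n : int) : (n%:~R <= pcoord p i -> n%:~R <= y i) /\
    (pcoord p i <= n%:~R -> y i <= n%:~R).
  have := yp i (chi (cell_origin (pcell p)) i + n).
  by rewrite heightE ffunE intrD !lerD2l.
have y01 i : 0 <= y i <= 1.
  have [+ _] := yp i 0; have [_] := yp i 1; have := coord_cube p i.
  by move=> /andP[x0 x1] -> // ->.
split.
  apply/forallP => i; case: ifP => [_|/negbT /coord_axes xi]; first exact: y01.
  have [_] := yp i 0; rewrite xi lexx => /(_ isT) y0.
  by rewrite eq_le y0; have /andP[] := y01 i.
move=> i; have /andP[y0 y1] := y01 i; split=> xi.
  by have [_] := yp i 0; rewrite xi lexx => /(_ isT) ?; apply/eqP; rewrite eq_le y0 andbT.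
by have [+ _] := yp i 1; rewrite xi lexx => /(_ isT) ?; apply/eqP; rewrite eq_le y1.
Qed.

Lemma move_point p v : compat (height p) v -> exists q, pcell q = pcell p /\ height q = v.
Proof.
set y : {ffun S -> R} := [ffun i => v i - (chi (cell_origin (pcell p)) i)%:~R].
have vE : v = [ffun i => (chi (cell_origin (pcell p)) i)%:~R + y i].
  by apply/ffunP => i; rewrite !ffunE addrC subrK.
rewrite vE => /support_faceP[yc _].
by exists (exist _ (pcell p, y) yc); split=> //; apply/ffunP => i; rewrite heightE ffunE.
Qed.

Lemma compat_support p q : pcell q = pcell p ->
  support_face (axes (pcell p)) (pcoord p) (pcoord q) <-> compat (height p) (height q).
Proof.
move=> qp; rewrite support_faceP; suff -> : height q =
  [ffun i => (chi (cell_origin (pcell p)) i)%:~R + pcoord q i] by [].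
by apply/ffunP => i; rewrite heightE ffunE qp.
Qed.

Lemma carrier_move p q g : pcell q = pcell p -> compat (height p) (height q) ->
  carrier q g <-> carrier p g /\ forall i, `|(chi g i)%:~R - height q i| < 1.
Proof.
move=> qp pq; split=> [/(carrierP gr)[cg near]|[/(carrierP gr)[cg _] near]].
  split=> //; apply/(carrierP gr); split; first by rewrite -qp.
  by move=> i; apply: compat_near (near i).
by apply/(carrierP gr); rewrite qp.
Qed.

(** Moving within the smallest face respects the gluing, since the new carrier is cut out of the old
    one by the new height alone. *)
Lemma cproj_move p q p' q' : cproj p = cproj q ->
  pcell p' = pcell p -> pcell q' = pcell q -> height p' = height q' ->
  compat (height p) (height p') -> cproj p' = cproj q'.
Proof.
move=> /cproj_eq[hpq cpq] pp qq hpq' pp'; apply/cproj_eq; split=> //.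
have qq' : compat (height q) (height q') by rewrite -hpq -hpq'.
apply/seteqP; split=> g /carrier_move H.
  by apply/(carrier_move _ qq qq'); rewrite -cpq -hpq'; exact: H.
by apply/(carrier_move _ pp pp'); rewrite cpq hpq'; exact: H.
Qed.

End Gluing.

(** * Euclidean estimates in the space of heights *)

Section Euclidean.
Local Open Scope ring_scope.
Context (R : realType) (S : finType).
Implicit Types x y z v h : {ffun S -> R}.

(** With [A], [B], [C] the three sums, the squares of [B * a i - C * b i] add up to
    [B * (A * B - C ^+ 2)]. *)
Lemma cauchy_schwarz (a b : S -> R) :
  (\sum_i a i * b i) ^+ 2 <= (\sum_i a i ^+ 2) * (\sum_i b i ^+ 2).
Proof.
set A := \sum_i a i ^+ 2; set B := \sum_i b i ^+ 2; set C := \sum_i _.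
have B0 : 0 <= B by apply: sumr_ge0 => i _; exact: sqr_ge0.
have [B0'|Bn0] := eqVneq B 0.
  have b0 i : b i = 0.
    apply/eqP; rewrite -sqrf_eq0; apply/eqP.
    by apply: (psumr_eq0P _ B0') => // k _; exact: sqr_ge0.
  by rewrite /C big1 ?expr0n/= ?B0' ?mulr0// => i _; rewrite b0 mulr0.
have {Bn0}B0 : 0 < B by rewrite lt0r Bn0.
have : 0 <= \sum_i (B * a i - C * b i) ^+ 2 by apply: sumr_ge0 => i _; exact: sqr_ge0.
have -> : \sum_i (B * a i - C * b i) ^+ 2 = B * (A * B - C ^+ 2).
  transitivity (\sum_i (B ^+ 2 * a i ^+ 2 + (- (2 * B * C) * (a i * b i) + C ^+ 2 * b i ^+ 2))).
    by apply: eq_bigr => i _; ring.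
  rewrite big_split big_split/= -!mulr_sumr -/A -/B -/C; ring.
by rewrite pmulr_rge0// subr_ge0.
Qed.

Lemma eucl_triangle x y z : eucl x z <= eucl x y + eucl y z.
Proof.
pose a i := x i - y i; pose b i := y i - z i.
have A0 : 0 <= \sum_i a i ^+ 2 by apply: sumr_ge0 => i _; exact: sqr_ge0.
have B0 : 0 <= \sum_i b i ^+ 2 by apply: sumr_ge0 => i _; exact: sqr_ge0.
rewrite -(ler_pXn2r (n := 2))// ?nnegrE ?addr_ge0 ?eucl_ge0//.
rewrite sqrrD /eucl -/a -/b !sqr_sqrtr//; last by apply: sumr_ge0 => i _; exact: sqr_ge0.
have -> : \sum_i (x i - z i) ^+ 2 =
    \sum_i a i ^+ 2 + (\sum_i a i * b i) *+ 2 + \sum_i b i ^+ 2.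
  rewrite -sumrMnl -!big_split/=; apply: eq_bigr => i _; rewrite /a /b; ring.
rewrite lerD2r lerD2l lerMn2r/= -sqrtrM//.
apply: le_trans (ler_norm _) _; rewrite -sqrtr_sqr; apply: ler_wsqrtr.
exact: cauchy_schwarz.
Qed.

Lemma coord_le_eucl x y i : `|x i - y i| <= eucl x y.
Proof.
rewrite -sqrtr_sqr /eucl ler_sqrt; last by apply: sumr_ge0 => k _; exact: sqr_ge0.
rewrite (bigD1 i)//= lerDl; apply: sumr_ge0 => k _; exact: sqr_ge0.
Qed.

Lemma eucl_eq0 x y : eucl x y = 0 -> x = y.
Proof.
move=> xy; apply/ffunP => i; apply/eqP; rewrite -subr_eq0 -normr_le0 -xy.
exact: coord_le_eucl.
Qed.

Lemma euclxx x : eucl x x = 0.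
Proof.
by rewrite /eucl big1 ?sqrtr0// => i _; rewrite subrr expr0n.
Qed.

Lemma eucl_scale x y x' y' (t : R) :
  (forall i, x' i - y' i = t * (x i - y i)) -> eucl x' y' = `|t| * eucl x y.
Proof.
move=> xy; rewrite /eucl -sqrtr_sqr -sqrtrM ?sqr_ge0// mulr_sumr.
by congr Num.sqrt; apply: eq_bigr => i _; rewrite xy exprMn.
Qed.

Lemma eucl_near (r : R) : 0 < r -> exists2 s : R, 0 < s &
  forall x y, (forall i, `|x i - y i| < s) -> eucl x y < r.
Proof.
move=> r0; exists (r / (#|S|.+1)%:R); first by rewrite divr_gt0// ltr0n.
move=> x y xy; rewrite -(ltr_pXn2r (n := 2)) ?nnegrE ?eucl_ge0 ?(ltW r0)//.
rewrite sqr_sqrtr; last by apply: sumr_ge0 => i _; exact: sqr_ge0.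
apply: (@le_lt_trans _ _ (\sum_(i : S) (r / #|S|.+1%:R) ^+ 2)).
  apply: ler_sum => i _; rewrite -[leLHS]real_normK ?num_real//.
  by rewrite ler_pXn2r ?nnegrE// ?(ltW (xy i))// divr_ge0// ltW.
rewrite sumr_const -[ltLHS]mulr_natr.
have N0 : 0 < (#|S|.+1%:R : R) by rewrite ltr0n.
apply: (@lt_le_trans _ _ ((r / #|S|.+1%:R) ^+ 2 * #|S|.+1%:R ^+ 2)).
  rewrite ltr_pM2l ?exprn_gt0 ?divr_gt0// -natrX ltr_nat.
  by rewrite -mulnn mulSn addSn ltnS leq_addr.
by rewrite -exprMn divfK// gt_eqF.
Qed.

(** The radius is the distance from [x] to the nearest integer different from [x]. *)
Lemma compat_ball1 (x : R) : exists2 r : R, 0 < r & forall (y : R) (n : int),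
  `|y - x| < r -> (n%:~R <= y -> n%:~R <= x) /\ (y <= n%:~R -> x <= n%:~R).
Proof.
have /andP[] := floor_itv x; set m := Num.floor x; rewrite intrD.
rewrite le_eqVlt => /predU1P[<- _|mx xm].
  exists 1 => // y n; rewrite ltr_norml => /andP[y0 y1]; split=> ny; rewrite ler_int.
    by rewrite -ltzD1 -(ltr_int R) intrD; lra.
  by rewrite -ltzD1 -(ltr_int R) intrD; lra.
exists (Num.min (x - m%:~R) (m%:~R + 1 - x)); first by rewrite lt_min; lra.
move=> y n; rewrite lt_min !ltr_norml => /andP[/andP[y1 y2] /andP[y3 y4]].
split=> ny.
  have : n <= m by rewrite -ltzD1 -(ltr_int R) intrD; lra.
  by rewrite -(ler_int R); lra.
have : m + 1 <= n by rewrite lezD1 -(ltr_int R); lra.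
by rewrite -(ler_int R) intrD; lra.
Qed.

(** A small ball around [v] lies in the open star of [v]: every cell whose interior it meets has [v]
    in its closure. *)
Lemma compat_ball v : exists2 r : R, 0 < r &
  forall h, (forall i, `|h i - v i| < r) -> compat h v.
Proof.
pose f i := s2val (cid2 (compat_ball1 (v i))).
exists (\big[Num.min/1]_i f i).
  by apply/bigmin_gtP; split=> // i _; exact: s2valP (cid2 (compat_ball1 (v i))).
move=> h hv i n; apply: (s2valP' (cid2 (compat_ball1 (v i)))).
by apply: lt_le_trans (hv i) _; apply: bigmin_le_cond.
Qed.

End Euclidean.

(** * Common cells, moves and strings in the realisation *)

Section Realization.
Local Open Scope ring_scope.
Context (R : realType) (S : finType) (e : rel S) (G : groupType) (K : set G).
Context (j : S -> G) (chi : G -> S -> int).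
Hypothesis gr : graded e K j chi.

Local Notation X := (salvetti e K j).
Local Notation point := (cube_point R X).
Local Notation space := (realization R X).
Local Notation height := (@height R S e G K j chi).
Implicit Types (p q : point) (x y z : space) (v w : {ffun S -> R}).

Definition cube_repr x : point := repr (x : {eq_quot (glue_equiv R X)}%qT).

Lemma cube_reprK x : cproj (cube_repr x) = x.
Proof. exact: reprK. Qed.

Definition rheight x : {ffun S -> R} := height (cube_repr x).

Lemma rheightE p : rheight (cproj p) = height p.
Proof. by have /(cproj_eq gr)[] := cube_reprK (cproj p). Qed.

Lemma salvetti_cubed_complex : is_cubed_complex R X.
Proof.
split=> [p q pq _ /(cproj_eq gr)[hpq _]|p q pq]; first exact: point_eq hpq.
have /(cproj_eq gr)[hpq cpq] := pq.
(* Translation by the difference of the origins changes coordinates from the cube of [p] to that of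
   [q] at constant height. *)
pose d i : R := (chi (cell_origin (pcell p)) i)%:~R - (chi (cell_origin (pcell q)) i)%:~R.
pose t (y : {ffun S -> R}) : {ffun S -> R} := [ffun i => d i + y i].
have tK (y : {ffun S -> R}) :
    [ffun i => (chi (cell_origin (pcell q)) i)%:~R + t y i] =
    [ffun i => (chi (cell_origin (pcell p)) i)%:~R + y i] :> {ffun S -> R}.
  by apply/ffunP => i; rewrite !ffunE /d addrA addrC [_ + (_ - _)]addrC subrK addrC.
exists t; split.
- split.
  + by move=> y /(support_faceP chi) yp; apply/(support_faceP chi); rewrite tK -hpq.
  + move=> y z _ _ /ffunP tyz; apply/ffunP => i.
    by have := tyz i; rewrite !ffunE; exact: addrI.
  + move=> y /(support_faceP chi); rewrite -hpq => yq.
    exists [ffun i => y i - d i]; last by apply/ffunP => i; rewrite !ffunE addrC subrK.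
    apply/(support_faceP chi); rewrite -tK; suff -> : t [ffun i => y i - d i] = y by [].
    by apply/ffunP => i; rewrite !ffunE addrC subrK.
- move=> y z _ _; rewrite /eucl; congr Num.sqrt; apply: eq_bigr => i _.
  by rewrite !ffunE opprD addrACA subrr add0r.
- move=> p' q' pp qq sp qE; apply: (cproj_move gr pq pp qq).
    apply/ffunP => i; have := congr1 (fun f : {ffun S -> R} => f i) (tK (pcoord p')).
    by rewrite !heightE !ffunE pp qq qE ffunE.
  exact/(compat_support chi).
Qed.

Definition cocell x y := exists p q, [/\ cproj p = x, cproj q = y & pcell p = pcell q].

(** Meaningful when [v] is compatible with the height of [x]; then [moveE] shows that the result
    does not depend on the cube chosen to represent [x]. *)
Definition move x v : space := xget x [set y | exists p q,
  [/\ cproj p = x, pcell q = pcell p, height q = v & cproj q = y]].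

Lemma cocell_sym x y : cocell x y -> cocell y x.
Proof. by move=> [p [q [px qy pq]]]; exists q, p. Qed.

Lemma cocell_refl x : cocell x x.
Proof. by exists (cube_repr x), (cube_repr x); rewrite cube_reprK. Qed.

Lemma cocell_cproj p q : pcell p = pcell q -> cocell (cproj p) (cproj q).
Proof. by exists p, q. Qed.

Lemma moveE p q : pcell q = pcell p -> compat (height p) (height q) ->
  move (cproj p) (height q) = cproj q.
Proof.
move=> qp pq; apply: xget_unique; first by exists p, q.
move=> y [p' [q' [pp' q'p' hq' <-]]].
apply: (cproj_move gr pp' q'p' qp hq').
by have /(cproj_eq gr)[-> _] := pp'; rewrite hq'.
Qed.

Lemma move_refl x : move x (rheight x) = x.
Proof. by rewrite -[in LHS](cube_reprK x) rheightE moveE ?cube_reprK. Qed.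

Lemma rheight_move x v : compat (rheight x) v -> rheight (move x v) = v.
Proof.
rewrite -(cube_reprK x) rheightE => xv; have [q [qx qv]] := move_point xv.
by rewrite -qv moveE ?rheightE// qv.
Qed.

Lemma cocell_move x y v : cocell x y -> compat (rheight x) v -> cocell (move x v) y.
Proof.
move=> [p [q [<- <- pq]]]; rewrite rheightE => xv.
have [p' [pp' pv]] := move_point xv.
by rewrite -pv moveE ?pv//; apply: cocell_cproj; rewrite pp'.
Qed.

Lemma cocell_eq x y : cocell x y -> rheight x = rheight y -> x = y.
Proof.
move=> [p [q [<- <- pq]]]; rewrite !rheightE => hpq.
by rewrite (point_eq pq hpq).
Qed.

Lemma cocell_moveE x y : cocell x y -> compat (rheight x) (rheight y) ->
  move x (rheight y) = y.
Proof. by move=> xy c; apply: cocell_eq; [exact: cocell_move|exact: rheight_move]. Qed.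

(** Here [x] lies in the smallest closed face containing [y], so every cell containing [y] contains
    [x]. *)
Lemma cocell_star x y z : cocell x y -> cocell y z ->
  compat (rheight y) (rheight x) -> cocell x z.
Proof.
move=> xy yz c; rewrite -(cocell_moveE (cocell_sym xy) c); exact: cocell_move.
Qed.

Lemma eucl_height p q : pcell p = pcell q ->
  eucl (height p) (height q) = eucl (pcoord p) (pcoord q).
Proof.
move=> pq; rewrite (@eucl_scale _ _ (pcoord p) (pcoord q) _ _ 1) ?normr1 ?mul1r// => i.
by rewrite !heightE pq opprD addrACA subrr add0r mul1r.
Qed.

Lemma segstring_cocell x y : cocell x y ->
  segstring x y (eucl (rheight x) (rheight y)).
Proof.
move=> [p [q [<- <- pq]]]; rewrite !rheightE eucl_height// -[eucl _ _]add0r.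
by apply: segstring_rcons => //; exact: segstring_nil.
Qed.

(** The height map is isometric on each cube, hence does not increase the length of strings. *)
Lemma segstring_rheight x y l : segstring x y l -> eucl (rheight x) (rheight y) <= l.
Proof.
elim=> [|{}l p q _ IH pq]; first by rewrite euclxx.
apply: le_trans (eucl_triangle _ (rheight (cproj p)) _) _.
by rewrite lerD// !rheightE eucl_height.
Qed.

(** Moving less than the distance [r] to the integral hyperplanes that avoid
   [x], one never leaves the open star of [x]. *)
Lemma segstring_star (r : R) x y l :
  (forall h : {ffun S -> R}, (forall i, `|h i - rheight x i| < r) -> compat h (rheight x)) ->
  segstring x y l -> l < r -> cocell x y.
Proof.
move=> rP; elim=> [|{}l p q xp IH pq] lr; first exact: cocell_refl.
have {}lr : l < r by apply: le_lt_trans lr; rewrite lerDl eucl_ge0.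
apply: (cocell_star (IH lr) (cocell_cproj pq)); apply: rP => i.
apply: le_lt_trans lr; rewrite distrC; apply: le_trans (segstring_rheight xp).
exact: coord_le_eucl.
Qed.

Definition interpolate p q (t : R) : point := xget p [set r : point |
  pcell r = pcell p /\ forall i, pcoord r i = (1 - t) * pcoord p i + t * pcoord q i].

Lemma interpolateP p q t : pcell p = pcell q -> 0 <= t <= 1 ->
  pcell (interpolate p q t) = pcell p /\
  forall i, pcoord (interpolate p q t) i = (1 - t) * pcoord p i + t * pcoord q i.
Proof.
move=> pq t01; apply: (@xgetPex _ p [set r : point | pcell r = pcell p /\
  forall i, pcoord r i = (1 - t) * pcoord p i + t * pcoord q i]).
set z : {ffun S -> R} := [ffun i => (1 - t) * pcoord p i + t * pcoord q i].
have zc : in_cube (axes (pcell p)) z.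
  apply/forallP => i; rewrite ffunE; have [ip|ip] := boolP (i \in _).
    have := coord_cube p i; have := coord_cube q i; nra.
  by rewrite !coord_axes// -?pq// !mulr0 addr0.
by exists (exist _ (pcell p, z) zc); split=> // i; rewrite [LHS]ffunE.
Qed.

Lemma eucl_interpolate p q s t : pcell p = pcell q -> 0 <= s <= 1 -> 0 <= t <= 1 ->
  eucl (pcoord (interpolate p q s)) (pcoord (interpolate p q t)) =
  `|t - s| * eucl (pcoord p) (pcoord q).
Proof.
move=> pq s01 t01; apply: eucl_scale => i.
have [_ ->] := interpolateP pq s01; have [_ ->] := interpolateP pq t01; ring.
Qed.

Lemma segstring_interpolate p q s t : pcell p = pcell q -> 0 <= s -> s <= t -> t <= 1 ->
  segstring (cproj (interpolate p q s)) (cproj (interpolate p q t))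
    ((t - s) * eucl (pcoord p) (pcoord q)).
Proof.
move=> pq s0 st t1; have s01 : 0 <= s <= 1 by lra. have t01 : 0 <= t <= 1 by lra.
have [ps _] := interpolateP pq s01; have [pt _] := interpolateP pq t01.
rewrite -[t - s]ger0_norm ?subr_ge0// -eucl_interpolate// -[eucl _ _]add0r.
by apply: segstring_rcons; [exact: segstring_nil|rewrite ps].
Qed.

Lemma interpolate0 p q : pcell p = pcell q -> interpolate p q 0 = p.
Proof.
move=> pq; have [|cE xE] := @interpolateP p q 0 pq; first by rewrite lexx ler01.
apply: (point_eq (chi := chi)) => //; apply/ffunP => i.
by rewrite !heightE cE xE subr0 mul1r mul0r addr0.
Qed.

Lemma interpolate1 p q : pcell p = pcell q -> interpolate p q 1 = q.
Proof.
move=> pq; have [|cE xE] := @interpolateP p q 1 pq; first by rewrite lexx ler01.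
apply: (point_eq (chi := chi)); rewrite ?cE//; apply/ffunP => i.
by rewrite !heightE cE xE subrr mul0r mul1r add0r pq.
Qed.

(** The string is parametrised by arc length, one segment at a time. *)
Lemma segstring_path x y l : segstring x y l -> exists c : R -> space,
  [/\ c 0 = x, c l = y &
    forall s t, 0 <= s -> s <= t -> t <= l -> segstring (c s) (c t) (t - s)].
Proof.
elim=> [|{}l p q xp [c [c0 cl cP]] pq].
  exists (fun=> x); split=> // s t s0 st t0; have -> : t - s = 0 by lra.
  exact: segstring_nil.
set d := eucl (pcoord p) (pcoord q); have d0 : 0 <= d := eucl_ge0 _ _.
have l0 := segstring_ge0 xp.
(* A degenerate last segment is dropped, because the parameter is divided by [d] below. *)
have [dE|dn] := eqVneq d 0.
  rewrite dE addr0; exists c; split=> //; rewrite cl; congr cproj.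
  apply: (point_eq (chi := chi)) => //; apply/ffunP => i.
  by rewrite !heightE pq (eucl_eq0 dE).
have {dn}d0 : 0 < d by rewrite lt0r dn.
exists (fun s => if s <= l then c s else cproj (interpolate p q ((s - l) / d))); split.
- by rewrite l0.
- by rewrite leNgt ltrDl d0/= addrC addKr divff ?gt_eqF// interpolate1.
move=> s t s0 st tl.
have td : (t - l) / d <= 1 by rewrite ler_pdivrMr// mul1r lerBlDl.
case: ifPn => sl; case: ifPn => tl'; first exact: cP.
(* The interval from [s] to [t] contains the junction; the string is cut at time [l]. *)
- rewrite -ltNge in tl'.
  have -> : t - s = (l - s) + ((t - l) / d - 0) * d by rewrite subr0 divfK ?gt_eqF//; lra.
  apply: (@segstring_cat _ _ _ _ (cproj p)); first by rewrite -cl; apply: cP.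
  rewrite -{1}(interpolate0 pq); apply: segstring_interpolate => //.
  by apply: divr_ge0; lra.
- by move: sl; rewrite (le_trans st tl').
rewrite -ltNge in sl.
have -> : t - s = ((t - l) / d - (s - l) / d) * d.
  by rewrite -mulrBl divfK ?gt_eqF//; lra.
apply: segstring_interpolate => //.
  by apply: divr_ge0; lra.
by rewrite ler_pM2r ?invr_gt0// lerD2r.
Qed.

End Realization.

(** * The length metric *)

Section FilterLemmas.
Local Open Scope ring_scope.

Lemma filter_forall_fin (I : finType) (T : Type) (F : set_system T)
    (P : I -> T -> Prop) : Filter F ->
  (forall i, F [set x | P i x]) -> F [set x | forall i, P i x].
Proof.
move=> FF FP.
suff H (s : seq I) : F [set x | forall i, i \in s -> P i x].
  by apply: filterS (H (enum I)) => x H' i; apply: H'; rewrite mem_enum.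
elim: s => [|i s IH]; first by apply: filterS filterT.
apply: filterS2 (FP i) IH => x Pi Ps k.
by rewrite inE => /predU1P[->//|]; exact: Ps.
Qed.

(** Compactness of the segment gives a cluster point [v]. If a neighbourhood of [v] had no preimage
    in [F], the complement would be in [F], against clustering. *)
Lemma ultra_bounded_cvg (R : realType) (T : Type) (F : set_system T)
    (f : T -> R) (B : R) : UltraFilter F -> (forall k, `|f k| <= B) ->
  exists v, forall s, 0 < s -> F [set k | `|f k - v| < s].
Proof.
move=> FU fB; have FP := ultra_proper.
have fB' : F [set k | `[- B, B]%classic (f k)].
  by apply: filterS filterT => k _ /=; rewrite in_itv/= -ler_norml; exact: fB.
have [v [_ vF]] := @segment_compact R (- B) B (f @ F) _ fB'.
exists v => s s0.
have [//|nF] := in_ultra_setVsetC [set k | `|f k - v| < s] FU.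
have [z [/= nz]] := vF [set z | ~ `|z - v| < s] _ nF (nbhsx_ballx v s s0).
by rewrite -ball_normE /= distrC.
Qed.

End FilterLemmas.

Section LengthSpace.
Local Open Scope ring_scope.
Context (R : realType) (S : finType) (e : rel S) (G : groupType) (K : set G).
Context (j : S -> G) (chi : G -> S -> int).
Hypothesis gr : graded e K j chi.

Local Notation X := (salvetti e K j).
Local Notation space := (realization R X).
Local Notation rheight := (@rheight R S e G K j chi).
Local Notation move := (@move R S e G K j chi).
Implicit Types (x y z : space) (v h : {ffun S -> R}).

Hypothesis strings : forall x y : space, exists l, segstring x y l.

Lemma length_dist_le x y l : segstring x y l -> (length_dist x y <= l%:E)%E.
Proof. by move=> xy; apply: ereal_inf_lbound; exists l. Qed.

Lemma length_distP x y : exists L : R, [/\ length_dist x y = L%:E, 0 <= L,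
  forall l, segstring x y l -> L <= l &
  forall r, 0 < r -> exists2 l, segstring x y l & l < L + r].
Proof.
have d0 : (0 <= length_dist x y)%E.
  by apply: le_ereal_inf_tmp => _ [l xy <-]; rewrite lee_fin; exact: segstring_ge0 xy.
have [l0 xy0] := strings x y; have dl := length_dist_le xy0.
exists (fine (length_dist x y)).
have dE : length_dist x y = (fine (length_dist x y))%:E.
  rewrite fineK// ge0_fin_numE//; exact: le_lt_trans dl (ltry _).
split=> //; first exact: fine_ge0.
- by move=> l /length_dist_le; rewrite dE lee_fin.
- move=> r r0; apply/length_ballP; rewrite /length_ball [X in (X < _)%E]dE lte_fin.
  by rewrite ltrDl.
Qed.

Lemma space_ballP x (r : R) y : ball x r y <-> exists2 l, segstring x y l & l < r.
Proof. exact: length_ballP. Qed.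

Lemma compat_star v : exists2 r : R, 0 < r &
  (forall h, (forall i, `|h i - v i| < r) -> compat h v) /\
  forall x y l, rheight x = v -> segstring x y l -> l < r -> cocell x y.
Proof.
have [r r0 rP] := compat_ball v; exists r => //; split=> // x y l xv.
by apply: (segstring_star gr); rewrite xv.
Qed.

Lemma length_metric : is_metric (@length_dist R S X).
Proof.
split=> [x y|x y|x y|x y z].
- by have [L [-> L0 _ _]] := length_distP x y; rewrite lee_fin.
- have [L [-> L0 Ll Le]] := length_distP x y; split=> [[LE]|xy]; last first.
    congr EFin; apply/eqP; rewrite eq_le L0 andbT; apply: Ll; rewrite xy.
    exact: segstring_nil.
  (* At distance 0 some string stays in the star of [x], so the points share a cell; their heights
     agree since the height map is 1-Lipschitz. *)
  have [r r0 [_ rP]] := compat_star (rheight x).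
  have [l xy] := Le r r0; rewrite LE add0r => lr.
  apply: (cocell_eq gr (rP _ _ _ erefl xy lr)); apply: eucl_eq0.
  apply/eqP; rewrite eq_le eucl_ge0 andbT; apply/ler_addgt0Pr => s s0.
  have [m xm] := Le s s0; rewrite LE => ms.
  exact: le_trans (segstring_rheight gr xm) (ltW ms).
- by congr ereal_inf; apply/seteqP; split=> _ [l xy <-]; exists l => //;
    exact: segstring_sym.
- have [L [-> _ Ll _]] := length_distP x z.
  have [M [-> _ _ Me]] := length_distP x y.
  have [N [-> _ _ Ne]] := length_distP y z.
  rewrite -EFinD lee_fin; apply/ler_addgt0Pr => s s0.
  have s2 : 0 < s / 2 by rewrite divr_gt0.
  have [m xm ms] := Me _ s2; have [n xn ns] := Ne _ s2.
  by apply: le_trans (Ll _ (segstring_cat xm xn)) _; lra.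
Qed.

Lemma length_complete : is_complete space.
Proof.
move=> F FF /cauchyP cF.
have cvg_height i : exists v : R, forall s, 0 < s -> F [set x | `|rheight x i - v| < s].
  have /cauchy_cvg/cvg_ex[v vP] : cauchy ((fun x => rheight x i) @ F).
    apply/cauchyP => s s0; have [x Fx] := cF s s0; exists (rheight x i).
    apply: (@filterS _ F _ (ball x s)) Fx => y /space_ballP[l xy ls].
    rewrite -ball_normE/=; apply: le_lt_trans ls.
    exact: le_trans (coord_le_eucl _ _ i) (segstring_rheight gr xy).
  exists v => s s0; rewrite (_ : [set x | _] = [set x | `|v - rheight x i| < s]).
    exact: (cvgr_dist_lt _ _ vP).
  by apply/seteqP; split=> x /=; rewrite distrC.
have [f fP] := boolp.choice cvg_height.
pose v : {ffun S -> R} := [ffun i => f i].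
have vP s : 0 < s -> F [set x | forall i, `|rheight x i - v i| < s].
  by move=> s0; apply: filter_forall_fin => i; rewrite /v ffunE; exact: fP.
have [r r0 [rc rP]] := compat_star v.
(* The move of [y0] to the limit height costs less than [r / 2] and each passage through [x0] twice
   less than [r / 4], so the total stays below [r]. *)
have r2 : 0 < r / 2 by rewrite divr_gt0. have r4 : 0 < r / 4 by rewrite divr_gt0.
have [s s0 sP] := @eucl_near R S _ r2.
have [x0 Fx0] := cF _ r4.
pose A := [set x | (forall i, `|rheight x i - v i| < r) /\
  (forall i, `|rheight x i - v i| < s)] `&` ball x0 (r / 4).
have FA : F A by apply: filterI => //; apply: filterI; exact: vP.
have [y0 [[y0r y0s] y0x]] := filter_ex FA.
have y0v := rc _ y0r; have av := rheight_move gr y0v.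
have ay0 : segstring (move y0 v) y0 (eucl v (rheight y0)).
  rewrite -[in eucl v _]av; apply: (segstring_cocell gr).
  exact: (cocell_move gr (cocell_refl y0) y0v).
have Acell y : A y -> cocell (move y0 v) y.
  move=> [_ /space_ballP[l xl lr]].
  move: y0x => /space_ballP[m xm mr].
  have aY := segstring_cat ay0 (segstring_cat (segstring_sym xm) xl).
  apply: (rP _ _ _ av aY); have := sP _ _ y0s; rewrite eucl_sym; lra.
(* Every point of [A] shares a cell with this candidate limit, so its distance to it is bounded by
   the distance of the heights, which tends to 0. *)
exists (move y0 v); apply/cvg_ballP => t t0.
have [s' s'0 s'P] := @eucl_near R S _ t0.
apply: filterS2 FA (vP _ s'0) => y Ay yv; apply/space_ballP.
exists (eucl v (rheight y)).
  by rewrite -[in eucl v _]av; exact/(segstring_cocell gr)/Acell.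
by rewrite eucl_sym; exact: s'P.
Qed.

End LengthSpace.

(** * Shortest strings, geodesics and path-connectedness *)

Section Geodesics.
Local Open Scope ring_scope.
Context (R : realType) (S : finType) (e : rel S) (G : groupType) (K : set G).
Context (j : S -> G) (chi : G -> S -> int).
Hypothesis gr : graded e K j chi.

Local Notation X := (salvetti e K j).
Local Notation space := (realization R X).
Local Notation rheight := (@rheight R S e G K j chi).
Local Notation move := (@move R S e G K j chi).
Implicit Types (x y z : space) (v h : {ffun S -> R}).

Hypothesis strings : forall x y : space, exists l, segstring x y l.

(** Constant speed on [0,1] gives strings of different lengths the same parameter interval. *)
Lemma segstring_unit_path x y l : segstring x y l -> exists c : R -> space,
  [/\ c 0 = x, c 1 = y & forall s t : R, 0 <= s <= 1 -> 0 <= t <= 1 ->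
    segstring (c s) (c t) (l * `|s - t|)].
Proof.
move=> xy; have l0 := segstring_ge0 xy.
have [c [c0 cl cP]] := segstring_path chi xy.
have cP' (s t : R) : 0 <= s -> s <= t -> t <= 1 ->
    segstring (c (l * s)) (c (l * t)) (l * `|s - t|).
  move=> s0 st t1; rewrite distrC ger0_norm ?subr_ge0// mulrBr.
  by apply: cP; [exact: mulr_ge0|exact: ler_wpM2l|exact: ler_piMr].
exists (fun s => c (l * s)); split; rewrite ?mulr0 ?mulr1//.
move=> s t /andP[s0 s1] /andP[t0 t1].
have [st|/ltW ts] := leP s t; first exact: cP'.
by apply: segstring_sym; rewrite distrC; exact: cP'.
Qed.

(** Along an ultrafilter, the heights of almost shortest paths converge to a
   path [H]; moving the points of these paths inside their own support faces
   to the heights [H t] turns almost all of them into strings of exactly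
   minimal length. *)
Lemma minimal_segstring x y (L : R) : 0 <= L ->
  (forall r, 0 < r -> exists2 l, segstring x y l & l < L + r) ->
  exists2 l, segstring x y l & l <= L.
Proof.
move=> L0 Lr.
have : forall k : nat, exists gl : (R -> space) * R,
  [/\ 0 <= gl.2, gl.2 < L + k.+1%:R^-1, gl.1 0 = x, gl.1 1 = y &
      forall s t : R, 0 <= s <= 1 -> 0 <= t <= 1 ->
      segstring (gl.1 s) (gl.1 t) (gl.2 * `|s - t|)].
  move=> k; have [|l xy lL] := Lr k.+1%:R^-1; first by rewrite invr_gt0 ltr0n.
  have [c [c0 c1 cP]] := segstring_unit_path xy.
  by exists (c, l); split=> //; exact: segstring_ge0 xy.
move=> /boolp.choice[gl glP].
pose g k := (gl k).1; pose len k := (gl k).2.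
have g0 k : g k 0 = x by have [] := glP k.
have g1 k : g k 1 = y by have [] := glP k.
have gP k (s t : R) : 0 <= s <= 1 -> 0 <= t <= 1 ->
  segstring (g k s) (g k t) (len k * `|s - t|) by have [_ _ _ _] := glP k; apply.
have len0 k : 0 <= len k by have [] := glP k.
have lenL k : len k <= L + k.+1%:R^-1 by have [_ /ltW] := glP k.
have lenL1 k : len k <= L + 1.
  by apply: le_trans (lenL k) _; rewrite lerD2l invf_le1// ?ler1n ?ltr0n.
(* [F] refines the cofinite filter, so the excess [k.+1%:R^-1] tends to 0 along it. *)
have [F [FU ooF]] := @ultraFilterLemma nat \oo _.
have FP := @ultra_proper _ _ FU.
have FF : Filter F by exact: filter_filter.
have glip k (s t : R) : 0 <= s <= 1 -> 0 <= t <= 1 ->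
    eucl (rheight (g k s)) (rheight (g k t)) <= len k * `|s - t|.
  by move=> s01 t01; exact: (segstring_rheight gr (gP k s t s01 t01)).
have I0 : 0 <= (0 : R) <= 1 by rewrite lexx ler01.
have I1 : 0 <= (1 : R) <= 1 by rewrite lexx ler01.
have : forall t : R, exists h : {ffun S -> R}, 0 <= t <= 1 ->
    forall s : R, 0 < s -> F [set k | forall i, `|rheight (g k t) i - h i| < s].
  move=> t; have [t01|t01] := boolP (0 <= t <= 1); last by exists [ffun=> 0].
  have : forall i, exists v : R, forall s : R, 0 < s -> F [set k | `|rheight (g k t) i - v| < s].
    move=> i; apply: (@ultra_bounded_cvg _ _ _ _ (`|rheight x i| + (L + 1))) => k.
    rewrite -[rheight (g k t) i](addrNK (rheight x i)) addrC.
    apply: le_trans (ler_normD _ _) _; rewrite lerD2l.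
    apply: le_trans (coord_le_eucl _ _ _) _; rewrite -(g0 k).
    apply: le_trans (glip k t 0 t01 I0) _; apply: le_trans (lenL1 k).
    by rewrite subr0 ler_piMr// ger0_norm; case/andP: t01.
  move=> /boolp.choice[f fP]; exists [ffun i => f i] => _ s s0.
  by apply: filter_forall_fin => i; rewrite ffunE; exact: fP.
move=> /boolp.choice[H HP].
(* The limit inherits the Lipschitz constant [L]: the error [r] is shared by the heights at [s],
   those at [t], and the excess length. *)
have Hlip (s t : R) : 0 <= s <= 1 -> 0 <= t <= 1 -> eucl (H s) (H t) <= L * `|s - t|.
  move=> s01 t01; apply/ler_addgt0Pr => r r0.
  have r3 : 0 < r / 3 by rewrite divr_gt0.
  have [d d0 dP] := @eucl_near R S _ r3.
  have Fr : F [set k | k.+1%:R^-1 < r / 3].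
    by apply: ooF; exact: near_infty_natSinv_lt (PosNum r3).
  have [k [[ks kt] kr]] := filter_ex (filterI (filterI (HP s s01 d d0) (HP t t01 d d0)) Fr).
  have st1 : `|s - t| <= 1 by rewrite ler_norml; lra.
  have := dP _ _ kt; have := dP _ _ ks; have := glip k s t s01 t01.
  have := eucl_triangle (H s) (rheight (g k s)) (H t).
  have := eucl_triangle (rheight (g k s)) (rheight (g k t)) (H t).
  rewrite (eucl_sym (H s) (rheight _)) => t1 t2 t3 t4 t5.
  have [u [u0 ku lu]] : exists u : R, [/\ 0 <= u, u < r / 3 & len k <= L + u].
    by exists k.+1%:R^-1; split=> //; rewrite invr_ge0 ler0n.
  have := ler_wpM2r (normr_ge0 (s - t)) lu.
  have := ler_wpM2l u0 st1; rewrite mulr1 mulrDl; lra.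
pose a t k := move (g k t) (H t).
have near (t r : R) : 0 <= t <= 1 -> 0 < r ->
    F [set k | compat (rheight (g k t)) (H t) /\ eucl (H t) (rheight (g k t)) < r].
  move=> t01 r0; have [d d0 dP] := @eucl_near R S _ r0.
  have [d' d'0 [d'P _]] := compat_star gr (H t).
  apply: filterS2 (HP t t01 d d0) (HP t t01 d' d'0) => k kd kd'.
  by split; [exact: d'P|rewrite eucl_sym; exact: dP].
have step (t : R) : 0 <= t <= 1 -> exists2 d : R, 0 < d & forall s : R, 0 <= s <= 1 ->
    `|t - s| < d -> F [set k | cocell (a t k) (a s k)].
  move=> t01; have [r r0 [_ rP]] := compat_star gr (H t).
  have r2 : 0 < r / 2 by rewrite divr_gt0.
  (* All paths have length at most [L + 1]. Going from [a t k] to [g k t] and on to [g k s] then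
     costs less than [r / 2] twice, which stays in the star of [a t k]. *)
  exists (r / 2 / (L + 1)); first by rewrite divr_gt0// ltr_wpDl.
  move=> s s01; rewrite ltr_pdivlMr ?ltr_wpDl// => ts.
  apply: filterS2 (near t _ t01 r2) (near s _ s01 r2) => k [ct et] [cs _].
  have ath : rheight (a t k) = H t := rheight_move gr ct.
  have atg := cocell_move gr (cocell_refl (g k t)) ct.
  apply/cocell_sym/(cocell_move gr) => //; apply/cocell_sym.
  apply: (rP _ _ _ ath (segstring_cat (segstring_cocell gr atg) (gP k t s t01 s01))).
  rewrite -/(a t k) ath; have := ler_wpM2r (normr_ge0 (t - s)) (lenL1 k).
  by rewrite mulrC in ts; lra.
(* Goodness of [t] spreads to nearby parameters, so a supremum argument carries it from 0 to 1; a
   single index [k] then gives the minimal string. *)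
pose good t := F [set k | exists2 l, segstring x (a t k) l & l <= L * t].
have extend (s t : R) : 0 <= s <= 1 -> 0 <= t <= 1 -> s <= t -> good s ->
    F [set k | cocell (a s k) (a t k)] -> good t.
  move=> s01 t01 st gs c; have n2 := @filterI _ F FF _ _ (near s 1 s01 ltr01) (near t 1 t01 ltr01).
  rewrite /good in gs *; apply: filterS3 gs n2 c => k [l xl lL] [[cs _] [ct _]] ck.
  exists (l + eucl (rheight (a s k)) (rheight (a t k))).
    exact: (segstring_cat xl (segstring_cocell gr ck)).
  rewrite !rheight_move//; have := Hlip s t s01 t01.
  by rewrite distrC ger0_norm ?subr_ge0//; lra.
(* The endpoints do not vary with [k], so moving them to the limit height leaves them fixed. *)
have H_end (t : R) z : 0 <= t <= 1 -> (forall k, g k t = z) -> H t = rheight z.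
  move=> t01 gz; apply: eucl_eq0; apply/eqP; rewrite eq_le eucl_ge0 andbT.
  apply/ler_addgt0Pr => r r0; rewrite add0r.
  by have [k [_]] := filter_ex (near t r t01 r0); rewrite gz => /ltW.
have good0 : good 0.
  rewrite /good; apply: filterS filterT => k _; exists 0; last by rewrite mulr0.
  by rewrite /a g0 (H_end 0 x)// move_refl//; exact: segstring_nil.
pose E := [set t : R | 0 <= t <= 1 /\ good t].
have supE : has_sup E.
  by split; [exists 0|exists 1 => t [/andP[]]].
have E0 : E 0 by [].
set m := sup E; have m01 : 0 <= m <= 1.
  apply/andP; split; first exact: ub_le_sup supE.2 _ E0.
  by apply: ge_sup; [exists 0|move=> t [/andP[]]].
have [d d0 dP] := step m m01.
have [s [s01 gs] sm] := sup_adherent d0 supE.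
have sm' : s <= m by apply: ub_le_sup; [exact: supE.2|].
have goodm : good m.
  apply: (extend s m) => //; have := dP s s01.
  rewrite ger0_norm ?subr_ge0// => H'.
  have {}H' := H' ltac:(rewrite -/m in sm; lra).
  by apply: filterS H' => k; exact: cocell_sym.
have m1 : m = 1.
  apply/eqP; rewrite eq_le; have /andP[_ ->] := m01; rewrite leNgt; apply/negP => m1.
  pose t := Num.min 1 (m + d / 2).
  have mt : m < t by rewrite /t lt_min m1 ltrDl divr_gt0.
  have t1 : t <= 1 by rewrite /t ge_min lexx.
  have td : t <= m + d / 2 by rewrite /t ge_min lexx orbT.
  have t01 : 0 <= t <= 1 by lra.
  have : good t.
    apply: (extend m t) => //; first exact: ltW.
    by apply: dP => //; rewrite distrC ger0_norm ?subr_ge0 ?ltW//; lra.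
  move=> gt; have : t <= m by apply: ub_le_sup; [exact: supE.2|].
  by rewrite leNgt mt.
rewrite m1 in goodm; have [k [l xl lL]] := filter_ex goodm.
exists l; last by rewrite mulr1 in lL.
by move: xl; rewrite /a g1 (H_end 1 y)// move_refl.
Qed.

Lemma length_geodesic : is_geodesic (@length_dist R S X).
Proof.
move=> x y; have [L [dE L0 Ll Lr]] := length_distP strings x y.
have [l xy lL] := minimal_segstring L0 Lr.
have {}lL : l = L by apply/eqP; rewrite eq_le lL Ll.
rewrite {}lL in xy; have [c [c0 cL cP]] := segstring_path chi xy.
(* A shorter string between two points of a minimal one could be spliced in and would shorten the
   whole. *)
have dc (s t : R) : 0 <= s -> s <= t -> t <= L -> length_dist (c s) (c t) = (t - s)%:E.
  move=> s0 st tL; have [M [-> _ Ml Mr]] := length_distP strings (c s) (c t).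
  congr EFin; apply: le_anti; rewrite (Ml _ (cP s t s0 st tL))/=.
  apply/ler_addgt0Pr => r r0.
  have [n sn nM] := Mr r r0.
  have xs := cP 0 s (lexx _) s0 (le_trans st tL).
  have ty := cP t L (le_trans s0 st) tL (lexx _).
  rewrite c0 in xs; rewrite cL in ty.
  by have := Ll _ (segstring_cat xs (segstring_cat sn ty)); lra.
exists L, c; split=> // s t /andP[s0 sL] /andP[t0 tL].
have [st|/ltW ts] := leP s t; first by rewrite dc// distrC ger0_norm ?subr_ge0.
have [_ _ dC _] := length_metric gr strings.
by rewrite dC dc// ger0_norm ?subr_ge0.
Qed.

Lemma length_path_connected : path_connected R space.
Proof.
move=> x y; have [l xy] := strings x y; have l0 := segstring_ge0 xy.
have [c [c0 c1 cP]] := segstring_unit_path xy.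
exists c; split=> //; apply/subspace_continuousP => s s01.
have {}s01 : 0 <= s <= 1 by move: s01; rewrite /= in_itv.
apply/cvg_ballP => r r0; rewrite near_withinE.
have d0 : 0 < r / (l + 1) by rewrite divr_gt0// ltr_wpDl.
apply: filterS (nbhsx_ballx s _ d0) => t; rewrite -ball_normE/= => st t01.
have {}t01 : 0 <= t <= 1 by move: t01; rewrite /= in_itv.
apply/space_ballP; exists (l * `|s - t|); first exact: cP.
move: st; rewrite ltr_pdivlMr ?ltr_wpDl//; have := normr_ge0 (s - t); lra.
Qed.

Lemma length_connected : connected [set: space].
Proof.
have [[x _]|noX] := pselect (exists x : space, True); last first.
  have -> : [set: space] = set0.
    by apply/seteqP; split=> // x _; case: noX; exists x.
  exact: connected0.
have [c cP] := boolp.choice (length_path_connected x).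
have -> : [set: space] = \bigcup_(y in setT) (c y @` `[0, 1]%classic).
  apply/seteqP; split=> // y _; exists y => //=; have [_ _ cy] := cP y.
  by exists 1 => //=; rewrite in_itv/= ler01 lexx.
apply: bigcup_connected; last first.
  move=> y _; have [cc _ _] := cP y.
  by apply: connected_continuous_connected cc; exact: segment_connected.
exists x => y _; have [_ cx _] := cP y.
by exists 0 => //=; rewrite in_itv/= ler01 lexx.
Qed.

End Geodesics.

(** * Dimension, vertices and strings between arbitrary points *)

Section Vertices.
Local Open Scope ring_scope.
Context (R : realType) (S : finType) (e : rel S) (G : groupType) (K : set G).
Context (j : S -> G) (chi : G -> S -> int).
Hypothesis gr : graded e K j chi.

Local Notation X := (salvetti e K j).
Local Notation point := (cube_point R X).
Local Notation space := (realization R X).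
Local Notation vertex := (@salvetti_vertex S e R G K j).

Lemma salvetti_has_dim : has_dim X (clique_dim e).
Proof.
split=> [c|]; first by apply: leq_bigmax_cond; exact: (valP c).
have [|T cT dT] := @eq_bigmax_cond _ (clique e) (fun T : {set S} => #|T|).
  by apply/card_gt0P; exists finset.set0; exact: clique0.
by exists (exist _ (1%g, T) cT); rewrite /clique_dim dT.
Qed.

Lemma face_set_point (c : cell X) D :
  face_set c D finset.set0 = lcoset K (cell_origin c * cube_vertex j D)%g.
Proof.
apply/seteqP; split=> [g [D']|g /lcosetP Kg].
  by rewrite finset.subset0 => /eqP ->; rewrite finset.setU0 => ?; exact/lcosetP.
by exists finset.set0; rewrite ?finset.setU0.
Qed.

Lemma cproj_corner (p : point) (D : {set S}) :
  (forall i, pcoord p i = (i \in D)%:R) ->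
  cproj p = vertex (cell_origin (pcell p) * cube_vertex j D)%g.
Proof.
move=> pD; apply/(cproj_eq gr); split.
  apply/ffunP => i; rewrite !heightE pD ffunE addr0.
  by rewrite (gradedM gr) (chi_cube_vertex gr) intrD; case: (i \in D).
have onesD : ones p = D.
  by apply/setP => i; rewrite inE pD; case: (i \in D); rewrite ?eqxx// eq_sym oner_eq0.
have inner0 : inner p = finset.set0.
  by apply/setP => i; rewrite !inE pD; case: (i \in D); rewrite ltxx ?andbF.
rewrite /carrier onesD inner0 face_set_point; set q := exist _ _ _.
have -> : ones q = finset.set0 by apply/setP => i; rewrite !inE ffunE eq_sym oner_eq0.
have -> : inner q = finset.set0 by apply/setP => i; rewrite !inE ffunE ltxx.
by rewrite face_set_point /cube_vertex big_set0 mulg1.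
Qed.

Lemma corner_in_cube (T D : {set S}) : D \subset T ->
  in_cube T [ffun i => (i \in D)%:R : R].
Proof.
move=> /fintype.subsetP DT; apply/forallP => i; rewrite ffunE.
have := DT i; case: (i \in D) => [->//|_]; first by rewrite ler01 lexx.
by case: ifP => // _; rewrite lexx ler01.
Qed.

Definition corner_point (c : cell X) (D : {set S}) (DT : D \subset axes c) : point :=
  exist _ (c, _) (corner_in_cube DT).

Lemma cproj_corner_point (c : cell X) (D : {set S}) (DT : D \subset axes c) :
  cproj (corner_point DT) = vertex (cell_origin c * cube_vertex j D)%g.
Proof. by apply: cproj_corner => i; rewrite [LHS]ffunE. Qed.

Lemma vertex_eq g h : K (g^-1 * h)%g -> vertex g = vertex h.
Proof.
move=> Kgh; pose c g : cell X := exist _ (g, finset.set0) (clique0 e).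
have cE g' : vertex g' = cproj (corner_point (finset.sub0set (axes (c g')))).
  by rewrite cproj_corner_point /cube_vertex big_set0 mulg1.
rewrite !cE; apply/(cproj_eq gr); split.
  by apply/ffunP => i; rewrite !heightE (chi_coset gr i Kgh).
have innerE g' (q := corner_point (finset.sub0set (axes (c g')))) : inner q = finset.set0.
  by apply/setP => i; rewrite !inE [pcoord _ _]ffunE finset.in_set0 ltxx.
have onesE g' (q := corner_point (finset.sub0set (axes (c g')))) : ones q = finset.set0.
  by apply/setP => i; rewrite !inE [pcoord _ _]ffunE finset.in_set0 eq_sym oner_eq0.
rewrite /carrier !innerE !onesE !face_set_point /cube_vertex big_set0 !mulg1.
exact/(lcoset_eq (gradedK gr)).
Qed.

Hypothesis generated : forall P : G -> Prop, P 1%g ->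
  (forall k g, K k -> P g -> P (g * k)%g) -> (forall t g, P g -> P (g * j t)%g) ->
  (forall t g, P g -> P (g * (j t)^-1)%g) -> forall g, P g.

Lemma clique1 t : clique e [set t]%SET.
Proof.
apply/forall_inP => s; rewrite inE => /eqP ->; apply/forall_inP => s'.
by rewrite inE => /eqP ->; rewrite eqxx.
Qed.

Lemma segstring_cell (p q : point) : pcell p = pcell q ->
  exists l, segstring (cproj p) (cproj q) l.
Proof.
move=> pq; exists (0 + eucl (pcoord p) (pcoord q)).
by apply: segstring_rcons => //; exact: segstring_nil.
Qed.

(** Right multiplication by [K] fixes the vertex, and by a generator or its inverse it crosses an
    edge. So all vertices are reached, and every point is joined to the origin of its cube. *)
Lemma salvetti_strings (x y : space) : exists l, segstring x y l.
Proof.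
pose base := vertex 1%g.
suff H z : exists l, segstring base z l.
  have [l xl] := H x; have [m ym] := H y.
  by exists (l + m); exact: segstring_cat (segstring_sym xl) ym.
have edge t g : exists l, segstring (vertex g) (vertex (g * j t)%g) l.
  pose c : cell X := exist _ (g, [set t]%SET) (clique1 t).
  have := @segstring_cell (corner_point (finset.sub0set (axes c)))
    (corner_point (fintype.subxx (axes c))) erefl.
  by rewrite !cproj_corner_point /cube_vertex big_set0 big_set1 mulg1.
have vert g : exists l, segstring base (vertex g) l.
  move: g; apply: generated => [|k g Kk|t g|t g]; first by exists 0; exact: segstring_nil.
  - by move=> [l gl]; exists l; rewrite -(vertex_eq (g := g))// mulKg.
  - move=> [l gl]; have [m gm] := edge t g.
    by exists (l + m); exact: segstring_cat gl gm.
  - move=> [l gl]; have [m] := edge t (g * (j t)^-1)%g; rewrite mulgVK => gm.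
    by exists (l + m); exact: segstring_cat gl (segstring_sym gm).
rewrite -(cube_reprK z); set p := cube_repr z.
have [l gl] := vert (cell_origin (pcell p)).
have [m gm] := @segstring_cell (corner_point (finset.sub0set (axes (pcell p)))) p erefl.
exists (l + m); apply: segstring_cat gl _; move: gm.
by rewrite cproj_corner_point /cube_vertex big_set0 mulg1.
Qed.

End Vertices.

(** * Embeddings induced by group homomorphisms *)

Section Embedding.
Local Open Scope ring_scope.
Context (R : realType) (S : finType) (e : rel S).
Context (G1 G2 : groupType) (K1 : set G1) (K2 : set G2).
Context (j1 : S -> G1) (j2 : S -> G2) (chi1 : G1 -> S -> int) (chi2 : G2 -> S -> int).
Hypothesis gr1 : graded e K1 j1 chi1.
Hypothesis gr2 : graded e K2 j2 chi2.

Local Notation X1 := (salvetti e K1 j1).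
Local Notation X2 := (salvetti e K2 j2).

Context (psi : G1 -> G2).
Hypothesis psiM : {morph psi : x y / (x * y)%g}.
Hypothesis psij : forall t, psi (j1 t) = j2 t.
Hypothesis psiK : forall g, K2 (psi g) <-> K1 g.
Hypothesis psi_chi : forall g s, chi2 (psi g) s = chi1 g s.

Definition push_cell (c : cell X1) : cell X2 :=
  exist _ (psi (cell_origin c), axes c) (valP c).

Definition push (p : cube_point R X1) : cube_point R X2 :=
  exist _ (push_cell (pcell p), pcoord p) (valP p).

Lemma psi_corner c D :
  psi (cell_origin c * cube_vertex j1 D)%g =
  (cell_origin (push_cell c) * cube_vertex j2 D)%g.
Proof.
rewrite psiM /cube_vertex (morphism_prod psiM); congr ( _ * _)%g.
by apply: eq_bigr => t _; exact: psij.
Qed.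

Lemma psi_coset g h : K2 ((psi g)^-1 * psi h)%g <-> K1 (g^-1 * h)%g.
Proof. by rewrite -(morphismV psiM) -psiM. Qed.

Lemma carrier_push p g : carrier (push p) (psi g) <-> carrier p g.
Proof.
split=> -[D DT Kg]; exists D => //.
  by apply/psi_coset; rewrite (psi_corner (pcell p)).
by rewrite -[X in (X^-1 * _)%g](psi_corner (pcell p)); apply/psi_coset.
Qed.

(** [carrier_push] tests only elements in the image of [psi]. Each coset in the carrier of [push p]
    contains such an element, the image of a vertex of [p], and this suffices. *)
Lemma carrier_push_sub p q : carrier p = carrier q ->
  carrier (push p) `<=` carrier (push q).
Proof.
move=> pq h [D DT]; rewrite -[X in (X^-1 * _)%g](psi_corner (pcell p)) => Kh.
have : carrier p (cell_origin (pcell p) * cube_vertex j1 (ones p :|: D))%g.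
  by exists D; rewrite // mulVg; case: (gradedK gr1).
rewrite pq => -[D' DT' /psi_coset]; rewrite (psi_corner (pcell q)) => Kg.
exists D' => //; have [_ KM _] := gradedK gr2.
by have := KM _ _ Kg Kh; rewrite -mulgA mulVKg.
Qed.

Lemma height_push p : height chi2 (push p) = height chi1 p.
Proof. by apply/ffunP => i; rewrite !heightE psi_chi. Qed.

Lemma cproj_push p q : cproj (push p) = cproj (push q) <-> cproj p = cproj q.
Proof.
split=> /cproj_eq.
  move=> /(_ _ gr2)[hpq cpq]; apply/(cproj_eq gr1); split.
    by rewrite -!height_push.
  by apply/seteqP; split=> g /carrier_push H; apply/carrier_push; move: H; rewrite cpq.
move=> /(_ _ gr1)[hpq cpq]; apply/(cproj_eq gr2); split.
  by rewrite !height_push.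
by apply/seteqP; split; exact: carrier_push_sub.
Qed.

Lemma salvetti_embedding : exists f : realization R X1 -> realization R X2,
  is_cubed_embedding f /\
  forall g, f (salvetti_vertex e R K1 j1 g) = salvetti_vertex e R K2 j2 (psi g).
Proof.
pose f (x : realization R X1) := cproj (push (cube_repr x)).
have fE p : f (cproj p) = cproj (push p) by apply/cproj_push; exact: cube_reprK.
exists f; split; first split.
- by move=> x y; rewrite -{2}(cube_reprK x) -{2}(cube_reprK y) => /cproj_push.
- move=> c; exists (push_cell c), id; split=> //.
    by split=> // x xc; exists x.
  by move=> p pc; exists (push p); rewrite fE; split=> //; rewrite -pc.
move=> g; rewrite fE; congr cproj; apply: (point_eq (chi := chi2)).
  by apply: val_inj.
by apply/ffunP => i; rewrite !heightE !ffunE.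
Qed.

End Embedding.

(** * The 1-skeleton *)

(** [g] factors through [f], so its range is an image of that of [f]. *)
Lemma finite_range_kernel (T : choiceType) (A B : Type) (f : T -> A) (g : T -> B) :
  (forall x y, f x = f y -> g x = g y) -> finite_set (range f) -> finite_set (range g).
Proof.
move=> fg; have [[x0 _]|noT] := pselect (exists x : T, True); last first.
  move=> _; suff -> : range g = set0 by exact: finite_set0.
  by apply/seteqP; split=> // b [x _ _]; case: noT; exists x.
move=> fin; pose h a := g (xget x0 [set x | f x = a]).
apply: (@sub_finite_set _ _ (h @` range f)); last exact: finite_image.
move=> _ [x _ <-]; exists (f x); first by exists x.
apply: fg; suff : [set y | f y = f x] (xget x0 [set y | f y = f x]) by [].
by apply: xgetPex; exists x.
Qed.

(** If the index were infinite, the complements of finite unions of cosets would generate a proper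
    filter; a cluster point [u] contradicts its own open coset. *)
Lemma compact_finite_index (G : preTopologicalGroupType) (K : set G) :
  group_topology G -> is_subgroup K -> open K -> compact [set: G] -> finite_index K.
Proof.
move=> gtG sK oK cG; apply: contrapT => infinite.
pose F : set_system G := [set A | exists D : set (set G),
  [/\ finite_set D, D `<=` range (lcoset K) & forall x, ~ (\bigcup_(c in D) c) x -> A x]].
have FF : Filter F.
  split=> [|A B [D [fD DK DA]] [E [fE EK EB]]|A B AB [D [fD DK DA]]].
  - by exists set0; split=> //; exact: finite_set0.
  - exists (D `|` E); split; first by rewrite finite_setU.
      by move=> c [Dc|Ec]; [exact: DK|exact: EK].
    move=> x nx; split.
      by apply: DA; apply: contra_not nx => -[c Dc cx]; exists c; [left|].
    by apply: EB; apply: contra_not nx => -[c Ec cx]; exists c; [right|].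
  - by exists D; split=> // x nx; apply: AB; exact: DA.
have FP : ProperFilter F.
  split=> // -[D [fD DK D0]]; apply: infinite; apply: sub_finite_set fD => _ [x _ <-].
  have [c Dc cx] : (\bigcup_(c in D) c) x by apply: contrapT => /D0.
  have [y _ cE] := DK _ Dc; move: Dc cx; rewrite -cE => Dy /lcosetP Kyx.
  by have /(lcoset_eq sK) <- := Kyx.
have [u [_ Fu]] := cG F FP filterT.
have nu : nbhs u (lcoset K u).
  apply: open_nbhs_nbhs; split; last by apply/lcosetP; rewrite mulVg; case: sK.
  have -> : lcoset K u = [set x | K (u^-1 * x)%g].
    by apply/seteqP; split=> x /lcosetP.
  exact: open_mulgl.
have [|x []//] := Fu (~` lcoset K u) _ _ nu.
exists [set lcoset K u]; split; first exact: finite_set1.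
  by move=> _ ->; exists u.
by move=> x nx ux; apply: nx; exists (lcoset K u).
Qed.

Section OneSkeleton.
Context (S : finType) (e : rel S) (G : groupType) (K : set G).
Context (j : S -> G) (chi : G -> S -> int).
Hypothesis gr : graded e K j chi.

Local Notation X := (salvetti e K j).
Let sK : is_subgroup K := gradedK gr.

Definition edge_set (t : S) (g : G) : set (set G) :=
  [set lcoset K g; lcoset K (g * j t)%g].

Lemma cell_vertices1 (c : cell X) t : axes c = [set t]%SET ->
  cell_vertices c = edge_set t (cell_origin c).
Proof.
move=> ct; rewrite /cell_vertices ct; apply/seteqP; split=> [_ [D + <-]|v].
  rewrite /= finset.subset1 => /orP[] /eqP ->; rewrite finset.set0U.
    by right; rewrite /= big_set1.
  by left; rewrite /= big_set0 mulg1.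
case=> ->; first by exists finset.set0; rewrite /= ?finset.sub0set// finset.set0U big_set0 mulg1.
by exists [set t]%SET; rewrite //= finset.set0U big_set1.
Qed.

Lemma gedgeP (E : set (set G)) : gedge (skeleton1 X) E <-> exists t g, E = edge_set t g.
Proof.
split=> [[c [/eqP/cards1P[t ct] ->]]|[t [g ->]]].
  by exists t, (cell_origin c); exact: cell_vertices1.
exists (exist _ (g, [set t]%SET) (clique1 e t)); split; first exact: cards1.
by apply/esym; exact: cell_vertices1.
Qed.

Lemma gvertP (v : set G) : gvert (skeleton1 X) v <-> exists g, v = lcoset K g.
Proof.
split=> [[c [D _ <-]]|[g ->]].
  by exists (cell_origin c * cube_vertex j (finset.set0 :|: D))%g.
exists (exist _ (g, finset.set0) (clique0 e)), finset.set0; first exact: finset.sub0set.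
by rewrite /= finset.set0U big_set0 mulg1.
Qed.

(** The exponent sum of [t] is constant on cosets and differs by 1 between the two ends. *)
Lemma edge_ends t g : lcoset K g <> lcoset K (g * j t)%g.
Proof.
move=> /(lcoset_eq sK); rewrite mulKg => /(graded0 gr t).
by rewrite (gradedj gr) eqxx.
Qed.

Lemma skeleton1_simplicial : simplicial_graph (skeleton1 X).
Proof.
move=> E /gedgeP[t [g ->]]; exists (lcoset K g), (lcoset K (g * j t)%g).
by split=> //; [apply/gvertP; exists g|apply/gvertP; exists (g * j t)%g|exact: edge_ends].
Qed.

Definition neighbours (t : S) : set (set G) :=
  [set lcoset K (k * j t)%g | k in K] `|` [set lcoset K (k * (j t)^-1)%g | k in K].

Lemma skeleton1_locally_finite : locally_finite_graph (skeleton1 X) <->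
  forall t, finite_set (neighbours t).
Proof.
have [K1 KM KV] := sK.
split=> [lf t|fin v /gvertP[g ->]].
  have lf1 := lf (lcoset K 1%g) ((gvertP _).2 (ex_intro _ 1%g erefl)).
  (* A neighbour of the base vertex is recovered from the edge joining the two. *)
  pose f (w : set G) : set (set G) := [set lcoset K 1%g; w].
  have f_inj : injective f.
    move=> v w vw; have : f v v by right. have : f w w by right.
    by rewrite -{1}vw {2}vw => -[->|->//] [->|].
  apply: sub_finite_set (finite_preimage (in2W f_inj) lf1) => _ [] [k Kk <-].
    split; last by left.
    apply/gedgeP; exists t, k; rewrite /f /edge_set.
    by have -> : lcoset K 1%g = lcoset K k by apply/(lcoset_eq sK); rewrite invg1 mul1g.
  split; last by left.
  apply/gedgeP; exists t, (k * (j t)^-1)%g; rewrite /f /edge_set mulgVK setUC.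
  by have -> : lcoset K 1%g = lcoset K k by apply/(lcoset_eq sK); rewrite invg1 mul1g.
(* Translation by [g] carries the edges at the base vertex onto the edges at [lcoset K g]. *)
pose f (w : set G) : set (set G) := [set lcoset K g; [set (g * x)%g | x in w]].
apply: (@sub_finite_set _ _ (\bigcup_(t in [set: S]) (f @` neighbours t))); last first.
  by apply: bigcup_finite => [|t _]; [exact: finite_finset|exact: finite_image].
move=> E [/gedgeP[t [h ->]] gE]; exists t => //.
have [gh|gh] := gE.
  have Kgh : K (g^-1 * h)%g by exact/(lcoset_eq sK).
  exists (lcoset K (g^-1 * h * j t)%g); first by left; exists (g^-1 * h)%g.
  by rewrite /f lcoset_mul gh !mulgA mulgV mul1g.
have Kgh : K (g^-1 * (h * j t))%g by exact/(lcoset_eq sK).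
exists (lcoset K (g^-1 * (h * j t) * (j t)^-1)%g).
  by right; exists (g^-1 * (h * j t))%g.
by rewrite /f lcoset_mul gh !mulgA mulgV mul1g mulgK setUC.
Qed.

Lemma skeleton1_connected :
  (forall P : G -> Prop, P 1%g -> (forall k g, K k -> P g -> P (g * k)%g) ->
    (forall t g, P g -> P (g * j t)%g) -> (forall t g, P g -> P (g * (j t)^-1)%g) ->
    forall g, P g) ->
  connected_graph (skeleton1 X).
Proof.
move=> generated; split; first by exists (lcoset K 1%g); apply/gvertP; exists 1%g.
have adjC v w : adjacent (skeleton1 X) v w -> adjacent (skeleton1 X) w v.
  by move=> [E [? ? ?]]; exists E.
have adj t g : adjacent (skeleton1 X) (lcoset K g) (lcoset K (g * j t)%g).
  by exists (edge_set t g); split; [apply/gedgeP; exists t, g|left|right].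
pose con := clos_refl_trans (set G) (adjacent (skeleton1 X)).
(* Both directions are carried along, since the closure in [con] is not symmetric by
   construction. *)
suff H g : con (lcoset K 1%g) (lcoset K g) /\ con (lcoset K g) (lcoset K 1%g).
  move=> v w /gvertP[g ->] /gvertP[h ->].
  by apply: (@rt_trans _ _ _ (lcoset K 1%g)); [exact: (H g).2|exact: (H h).1].
move: g; apply: generated => [|k g Kk|t g [gl gr']|t g [gl gr']].
- by split; exact: rt_refl.
- by have -> : lcoset K (g * k)%g = lcoset K g by apply/esym/(lcoset_eq sK); rewrite mulKg.
- split; first by apply: rt_trans gl _; apply: rt_step; exact: adj.
  by apply: rt_trans gr'; apply: rt_step; apply/adjC; exact: adj.
have := adj t (g * (j t)^-1)%g; rewrite mulgVK => tg.
split; first by apply: rt_trans gl _; apply: rt_step; exact: adjC.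
by apply: rt_trans gr'; exact: rt_step.
Qed.

End OneSkeleton.

(** * Local finiteness and Cayley--Abels graphs for the topological RAAG *)

Section TraagTopology.
Context (S : finType) (e : rel S) (U : topologicalGroupType).
Context (O : set U) (phi : U -> U).
Hypothesis O_subgroup : is_subgroup O.
Hypothesis O_open : open O.
Hypothesis phiM : {in O &, {morph phi : x y / (x * y)%g}}.
Hypothesis phi_inj : {in O &, injective phi}.
Hypothesis phi_cont : {within O, continuous phi}.
Hypothesis phi_open : forall V : set U, open V -> V `<=` O -> open (phi @` V).

Local Notation G := (traag e O phi).
Local Notation base := (@traag_base S e U O phi).
Local Notation gen := (@traag_gen S e U O phi).
Local Notation K := (range base).
Local Notation X := (salvetti_traag e O phi).

Let gtG : group_topology G :=
  traag_topologyP e O_subgroup O_open phiM phi_cont phi_open.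

Lemma traag_base_continuous : continuous base.
Proof.
apply/continuousP => V oV.
have oV' : open (quotgrp_pi (@traag_rels S e U O phi) @^-1` V) by exact: oV.
by have /continuousP/(_ _ oV') := @thnn_base_continuous S U O phi.
Qed.

Lemma traag_base_open V : open V -> open (base @` V).
Proof.
move=> /(@thnn_base_open S U O phi) oV.
have := quotgrp_pi_open (thnn_topologyP S O_subgroup O_open phiM phi_cont phi_open)
  (@traag_rels S e U O phi) oV.
by rewrite image_comp.
Qed.

(** The stabiliser in [U] of the neighbour along [t] is the image of [O] under [phi], and along the
    inverse of [t] it is [O]. So the two families of neighbours are counted by the two indices. *)
Lemma finite_neighbours t : finite_set (neighbours K gen t) <->
  finite_index O /\ finite_index (phi @` O).
Proof.
have sP := image_subgroup O_subgroup phiM.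
have sK : is_subgroup K by have [chi gr] := traag_graded e O phi; exact: gradedK gr.
have bM := @traag_baseM S e U O phi.
have imK (f : G -> set G) : [set f k | k in K] = range (f \o base).
  apply/seteqP; split=> [_ [_ [u _ <-] <-]|_ [u _ <-]]; first by exists u.
  by exists (base u) => //; exists u.
have iP u v : lcoset K (base u * gen t)%g = lcoset K (base v * gen t)%g <->
    lcoset (phi @` O) u = lcoset (phi @` O) v.
  rewrite (lcoset_eq sK) (lcoset_eq sP) invgM -!mulgA (mulgA (base u)^-1%g).
  rewrite -(morphismV bM) -bM; split=> [[w _ wE]|[w Ow wE]].
    apply: (@traag_conjV_base S e U O phi O_subgroup phiM phi_inj t _ w).
    by rewrite wE !mulgA mulgK.
  exists w => //; rewrite -wE.
  by apply: (@mulgI _ (gen t)); rewrite (traag_rel e phi t Ow) mulVKg.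
have iO u v : lcoset K (base u * (gen t)^-1)%g = lcoset K (base v * (gen t)^-1)%g <->
    lcoset O u = lcoset O v.
  rewrite (lcoset_eq sK) (lcoset_eq O_subgroup) invgM invgK -!mulgA.
  rewrite (mulgA (base u)^-1%g) -(morphismV bM) -bM; split=> [[w _ wE]|Ow].
    apply: (@traag_conj_base S e U O phi O_subgroup phiM phi_inj t _ w).
    by rewrite wE !mulgA mulgVK.
  exists (phi (u^-1 * v)%g) => //.
  by rewrite mulgA (traag_rel e phi t Ow) mulgK.
rewrite /neighbours finite_setU !imK /finite_index.
by split=> -[f1 f2]; split; [move: f2|move: f1|move: f2|move: f1];
  apply: finite_range_kernel => u v /=; (move=> /iO || move=> /iP).
Qed.

Lemma traag_locally_finite : (0 < #|S|)%N ->
  locally_finite_graph (skeleton1 X) <-> finite_index O /\ finite_index (phi @` O).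
Proof.
have [chi gr] := traag_graded e O phi => /card_gt0P[t _].
split=> [/(skeleton1_locally_finite gr)/(_ t)/finite_neighbours//|fin].
by apply/(skeleton1_locally_finite gr) => t'; exact/finite_neighbours.
Qed.

Lemma traag_generated (P : G -> Prop) : P 1%g ->
  (forall k g, K k -> P g -> P (g * k)%g) -> (forall t g, P g -> P (g * gen t)%g) ->
  (forall t g, P g -> P (g * (gen t)^-1)%g) -> forall g, P g.
Proof.
by move=> P1 PK Pg PV; apply: traag_ind => // u x; apply: PK; exists u.
Qed.

Lemma coset_stabiliser g :
  [set h : G | [set (h * x)%g | x in lcoset K g] = lcoset K g] =
  [set h | K (g^-1 * (h * g))%g].
Proof.
have sK : is_subgroup K by have [chi gr] := traag_graded e O phi; exact: gradedK gr.
apply/seteqP; split=> h /=; rewrite lcoset_mul.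
  by move=> /esym/(lcoset_eq sK).
by move=> Kh; apply/esym/(lcoset_eq sK).
Qed.

Lemma compact_cayley_abels : (0 < #|S|)%N -> compact [set: U] ->
  cayley_abels (skeleton1 X)
    (fun (g : G) (v : set G) => [set (g * x)%g | x in v]).
Proof.
move=> S0 cU; have [chi gr] := traag_graded e O phi.
have gtU := @group_topologyP U.
split.
- exact: skeleton1_simplicial gr.
- apply/(traag_locally_finite S0); split; first exact: compact_finite_index.
  apply: compact_finite_index => //; first exact: image_subgroup.
  by apply: phi_open.
- apply: skeleton1_connected gr traag_generated.
- by move=> v /gvertP[g ->]; rewrite lcoset_mul mul1g.
- move=> g h v /gvertP[g' ->].
  by rewrite /= (@lcoset_mul _ K h) (@lcoset_mul _ K g) lcoset_mul mulgA.
- by move=> g v /gvertP[h ->]; apply/gvertP; exists (g * h)%g; rewrite lcoset_mul.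
- move=> g E /gedgeP[t [h ->]]; apply/gedgeP; exists t, (g * h)%g.
  by rewrite /edge_set image_setU !image_set1 !lcoset_mul mulgA.
- move=> v w /gvertP[g ->] /gvertP[h ->]; exists (h * g^-1)%g.
  by rewrite lcoset_mul mulgVK.
- move=> v /gvertP[g ->]; rewrite coset_stabiliser.
  (* The stabiliser is a conjugate of the image of [U], hence a continuous image of a compact
     space. *)
  have -> : [set h | K (g^-1 * (h * g))%g] = (fun u => g * base u * g^-1)%g @` [set: U].
    apply/seteqP; split=> [h [u _ uE]|_ [u _ <-]].
      by exists u; rewrite // uE mulVKg mulgK.
    by exists u => //; rewrite mulgVK mulKg.
  apply: continuous_compact cU; apply: continuous_subspaceT.
  apply/continuousP => V oV.
  have oV' := open_mulgl gtG g (open_mulgr gtG (g^-1)%g oV).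
  by have /continuousP/(_ _ oV') := traag_base_continuous.
- move=> v /gvertP[g ->]; rewrite coset_stabiliser.
  have oK : open K by apply: traag_base_open; exact: openT.
  exact: (open_mulgr gtG g (open_mulgl gtG (g^-1)%g oK)).
Qed.

(** The stabiliser of the base vertex is the image of [U]. A cluster point of the image filter there
    pulls back to [U], because [base] is open and injective. *)
Lemma cayley_abels_compact :
  cayley_abels (skeleton1 X)
    (fun (g : G) (v : set G) => [set (g * x)%g | x in v]) -> compact [set: U].
Proof.
move=> /ca_stab_compact /(_ (lcoset K 1%g)) cK F FF _.
have {}cK : compact K.
  have -> : K = [set h | K (1^-1 * (h * 1))%g].
    by apply/seteqP; split=> h; rewrite /= invg1 mul1g mulg1.
  by rewrite -coset_stabiliser; apply: cK; apply/gvertP; exists 1%g.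
have FK : (base @ F) K by apply: (@filterS _ F _ setT) filterT => u _; exists u.
have [_ [[u _ <-] Fu]] := cK (base @ F) _ FK.
exists u; split=> // A B FA Bu.
have FA' : (base @ F) (base @` A) by apply: (@filterS _ F _ A) FA => a Aa; exists a.
have Bu' : nbhs (base u) (base @` B).
  move: Bu; rewrite nbhsE => -[C [oC Cu] CB].
  apply: (@filterS _ _ _ (base @` C)); first exact: image_subset.
  by apply: open_nbhs_nbhs; split; [exact: traag_base_open|exists u].
have [_ [[a Aa <-] [b Bb ab]]] := Fu _ _ FA' Bu'.
exists a; split=> //.
by rewrite -(traag_base_inj O_subgroup phiM phi_inj ab).
Qed.

End TraagTopology.

Theorem proposition5p6 (R : realType) (S : finType) (e : rel S)
    (U : topologicalGroupType) (O : set U) (phi : U -> U)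
    (S_nonempty : (0 < #|S|)%N) (e_sym : symmetric e) (e_irr : irreflexive e)
    (U_hausdorff : hausdorff_space U)
    (O_subgroup : is_subgroup O) (O_open : open O)
    (phiM : {in O &, {morph phi : x y / (x * y)%g}})
    (phi_inj : {in O &, injective phi})
    (phi_cont : {within O, continuous phi})
    (phi_open : forall V : set U, open V -> V `<=` O -> open (phi @` V)) :
  let Sigma := salvetti_raag e in
  let X := salvetti_traag e O phi in
  let G := traag e O phi in
  let d := @length_dist R S X in
  [/\ (* (1) *)
      is_cubed_complex R Sigma /\
      (exists f : realization R Sigma -> realization R X,
         is_cubed_embedding f /\
         forall a : raag e,
           f (salvetti_vertex e R [set 1%g] (@raag_gen S e) a) =
           salvetti_vertex e R (range (@traag_base S e U O phi))
             (@traag_gen S e U O phi) (raag_to_traag O phi a)),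
      (* (2) *)
      [/\ is_cubed_complex R X,
          path_connected R (realization R X),
          connected [set: realization R X],
          has_dim X (clique_dim e)
        & exists n, has_dim X n /\ has_dim Sigma n],
      (* (3) *)
      locally_finite_graph (skeleton1 X) <->
        finite_index O /\ finite_index (phi @` O),
      (* (4) *)
      locally_compact [set: U] ->
        (cayley_abels (skeleton1 X)
           (fun (g : G) (v : set G) => [set (g * x)%g | x in v]) <->
         compact [set: U])
    & (* (5) *)
      [/\ is_metric d, is_complete (realization R X) & is_geodesic d]].
Proof.
move=> Sigma X G d; have [chi gr] := traag_graded e O phi.
have rM := @raag_to_traagM S e U O phi.
(* Exponent sums on the abstract RAAG are pulled back along the canonical map, so heights are
   preserved by the embedding. *)
have gr1 : graded e [set 1%g : raag e] (@raag_gen S e) (chi \o @raag_to_traag S e U O phi).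
  split.
  - by split=> // [_ _ -> ->|_ ->] /=; rewrite ?mulg1 ?invg1.
  - exact: raag_genC.
  - by move=> x y s; rewrite /= rM (gradedM gr).
  - by move=> _ s ->; rewrite /= (morphism1 rM) (chi1 gr).
  - by move=> t s; rewrite /= raag_to_traag_gen (gradedj gr).
(* The retraction kills [U] and fixes the abstract RAAG, so only the neutral element lands in
   [U]. *)
have rK a : range (@traag_base S e U O phi) (raag_to_traag O phi a) <-> [set 1%g] a.
  have [r [rM' rb rr]] := raag_to_traag_retract e O phi.
  split=> [[u _ uE]|->]; first by rewrite /= -(rr a) -uE rb.
  by exists 1%g; rewrite // (morphism1 rM) (morphism1 (@traag_baseM S e U O phi)).
have strings := salvetti_strings gr (@traag_generated S e U O phi) (R := R).
split.
- split; first exact: salvetti_cubed_complex gr1.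
  by apply: (salvetti_embedding R gr1 gr rM) => //; exact: raag_to_traag_gen.
- split.
  + exact: salvetti_cubed_complex gr.
  + exact: (length_path_connected chi strings).
  + exact: (length_connected chi strings).
  + exact: salvetti_has_dim.
  + by exists (clique_dim e); split; exact: salvetti_has_dim.
- exact: traag_locally_finite.
- move=> _; split; first exact: cayley_abels_compact.
  exact: compact_cayley_abels.
- split.
  + exact: (length_metric gr strings).
  + exact: length_complete gr.
  + exact: (length_geodesic gr strings).
Qed.
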